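(* Let $\mu_n=\mu_n^{\mathrm{ball}(\alpha,d)}$ with $0<\alpha<d$ and let $A$ be the associated random cutout set. Almost surely, $\overline{\dim}_B(E\cap A)\le\dim_HE-\alpha$ for every self-similar set $E\subset\mathbb{R}^d$ with $\dim_HE>\alpha$ satisfying the open set condition.
   Context: Ball cutout $\mu_n^{\mathrm{ball}(\alpha,d)}$: let $r>0$ and let $\mathcal{Y}$ be a Poisson point process of balls whose intensity is the push-forward of $r\,\mathcal{L}^d\times\frac{ds}{s}$ on $\mathbb{R}^d\times(0,\infty)$ under $(t,s)\mapsto B(st,s/2)$. Set $A_n=B(0,1)\setminus\bigcup\{B\in\mathcal{Y}:2^{-n}\le\operatorname{diam}B<1\}$, $\alpha=r\,\mathcal{L}^d(B(0,1/2))$, $\mu_n=2^{\alpha n}\mathbf{1}_{A_n}$, and $A=\overline{\bigcap_nA_n}$. A self-similar set is the attractor of a finite iterated function system of contracting similarities of $\mathbb{R}^d$. *)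

(* Defs.v *)
From HB Require Import structures.
From mathcomp Require Import all_boot all_order all_algebra.
From mathcomp Require Import all_classical all_reals all_analysis.
Set Implicit Arguments. Unset Strict Implicit. Unset Printing Implicit Defensive.
Import Order.TTheory GRing.Theory Num.Theory.
Import numFieldNormedType.Exports.
Local Open Scope classical_set_scope.
Local Open Scope ring_scope.

Section Cutout.
Context {R : realType} {d : nat}.
Notation V := 'rV[R]_d.

Definition enorm (x : V) : R := Num.sqrt (\sum_(i < d) x ord0 i ^+ 2).

Definition eball (x : V) (rho : R) : set V := [set y | enorm (y - x) < rho].

(** Euclidean diameter (in \bar R; -oo for the empty set). *)
Definition ediam (U : set V) : \bar R :=
  ereal_sup [set e | exists x y, U x /\ U y /\ e = (enorm (x - y))%:E].

Definition box (a b : 'I_d -> R) : set V := [set x | forall i, a i <= x ord0 i < b i].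
Definition boxvol (a b : 'I_d -> R) : R := \prod_(i < d) (b i - a i).

Definition lebd (S : set V) : \bar R :=
  ereal_inf [set m | exists (a b : nat -> 'I_d -> R),
    (forall k i, a k i <= b k i) /\
    S `<=` \bigcup_k box (a k) (b k) /\
    m = (\sum_(k <oo) (boxvol (a k) (b k))%:E)%E].

(** The intensity measure r L^d x ds/s on R^d x (0,oo) (outer measure,
    infimum over countable covers by rectangles box x [c,e), 0 < c <= e). *)
Definition intensity (r : R) (S : set (V * R)) : \bar R :=
  ereal_inf [set m | exists (a b : nat -> 'I_d -> R) (c e : nat -> R),
    (forall k i, a k i <= b k i) /\ (forall k, 0 < c k <= e k) /\
    S `&` [set p | 0 < p.2] `<=`
      \bigcup_k (box (a k) (b k) `*` [set s | c k <= s < e k]) /\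
    m = (\sum_(k <oo) (r * boxvol (a k) (b k) * ln (e k / c k))%:E)%E].

Definition borel_pair (S : set (V * R)) : Prop := <<s open >> S.

(** Poisson probabilities (with the convention Poisson(0) = Dirac at 0). *)
Definition ppmf (lam : R) (k : nat) : R := lam ^+ k / (k`!)%:R * expR (- lam).

Section PPP.
Context {dO : measure_display} {Omega : measurableType dO}.
Variable (P : probability Omega R) (Y : Omega -> set (V * R)).

Definition count_event (S : set (V * R)) (k : option nat) : set Omega :=
  [set w | match k with
           | Some n => ((Y w `&` S) #= `I_n)%card
           | None => infinite_set (Y w `&` S) end].

Definition is_PPP (r : R) : Prop :=
  (forall w, Y w `<=` [set p | 0 < p.2]) /\
  (forall S k, borel_pair S -> measurable (count_event S k)) /\
  (forall S, borel_pair S ->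
     match intensity r S with
     | lam%:E => forall n, P (count_event S (Some n)) = (ppmf lam n)%:E
     | _ => P (count_event S None) = 1%E
     end) /\
  (forall (m : nat) (S : 'I_m -> set (V * R)) (k : 'I_m -> option nat),
     (forall i, borel_pair (S i)) ->
     (forall i j, i != j -> S i `&` S j = set0) ->
     P [set w | forall i, count_event (S i) (k i) w] =
       (\prod_(i < m) P (count_event (S i) (k i)))%E).

Definition cutA_n (n : nat) (w : Omega) : set V :=
  eball 0 1 `\` \bigcup_(p in [set p | Y w p /\ 2 ^- n <= p.2 < 1])
                    eball (p.2 *: p.1) (p.2 / 2).

Definition cutA (w : Omega) : set V := closure (\bigcap_n cutA_n n w).

End PPP.

Definition hcost (s : R) (U : set V) : \bar R :=
  if `[< U = set0 >] then 0%E else (fine (ediam U) `^ s)%:E.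

Definition hausdorff_delta (s delta : R) (E : set V) : \bar R :=
  ereal_inf [set m | exists U : nat -> set V,
    (forall k, (ediam (U k) <= delta%:E)%E) /\ E `<=` \bigcup_k U k /\
    m = (\sum_(k <oo) hcost s (U k))%E].

Definition hausdorff_measure (s : R) (E : set V) : \bar R :=
  ereal_sup [set hausdorff_delta s delta E | delta in [set delta | 0 < delta]].

Definition dimH (E : set V) : \bar R :=
  ereal_inf [set s%:E | s in [set s | 0 <= s /\ hausdorff_measure s E = 0%E]].

Definition covnum (delta : R) (F : set V) : \bar R :=
  ereal_inf [set (n%:R)%:E | n in [set n : nat | exists U : 'I_n -> set V,
    (forall i, (ediam (U i) <= delta%:E)%E) /\ F `<=` [set x | exists i, U i x]]].

Definition box_ratio (F : set V) (delta : R) : \bar R :=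
  match covnum delta F with
  | x%:E => (ln x / - ln delta)%:E
  | _ => +oo%E
  end.

Definition upper_box_dim (F : set V) : \bar R :=
  ereal_inf [set ereal_sup [set box_ratio F delta | delta in [set delta | 0 < delta < eps]]
            | eps in [set eps | 0 < eps <= 1]].

Definition is_similarity (f : V -> V) (rho : R) : Prop :=
  forall x y, enorm (f x - f y) = rho * enorm (x - y).

Definition self_similar_OSC (E : set V) : Prop :=
  exists (m : nat) (f : 'I_m -> V -> V) (rho : 'I_m -> R),
    (forall i, 0 < rho i < 1 /\ is_similarity (f i) (rho i)) /\
    E !=set0 /\ compact E /\ E = [set y | exists i, (f i @` E) y] /\
    (exists O : set V, open O /\ O !=set0 /\
       (forall i, f i @` O `<=` O) /\
       (forall i j, i != j -> f i @` O `&` f j @` O = set0)).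

End Cutout.

(* Main.v *)
Require Import Defs.
From HB Require Import structures.
From mathcomp Require Import all_boot all_order all_algebra.
From mathcomp Require Import all_classical all_reals all_analysis.
From mathcomp Require finmap.
From mathcomp Require Import measurable_realfun ring lra.
Import Order.TTheory GRing.Theory Num.Theory.
Import numFieldNormedType.Exports.
Set Implicit Arguments.
Unset Strict Implicit.
Unset Printing Implicit Defensive.
Local Open Scope classical_set_scope.
Local Open Scope ring_scope.

(** A point survives the cutouts up to scale [dl = 2^-n] with probability at most
    [C dl^a'], where [a' = (1 - 1/K)^d alpha] is as close to [alpha] as we like. If the
    distances of finitely many points are taken into account, the relevant parts of the
    Poisson process are disjoint, and the [q]-th moment of the number of surviving points
    of a finite set [X] is at most [q! G^q], [G] being a discrete energy of [X] for the
    kernel [(dl / |x - y|)^a']. Since [q] is arbitrary, this beats the exponentially many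
    discretised iterated function systems at scale [2^-n], and Borel-Cantelli gives an
    almost sure bound valid for all of them simultaneously.

    If [E] is self-similar with the open set condition and [H^t(E) = 0], then the sum of
    the [t]-th powers of the ratios is less than one. Grouping the cylinders of
    diameter about [2^-n] by letter counts gives polynomially many families of points
    which are [t]-regular down to scale [2^-n], so that their energy is at most
    [C n 2^(n (t - a'))]. Hence so many balls of radius [2^-n] cover [E] intersected
    with the cutout set, and [t] tends to the Hausdorff dimension of [E]. *)

(** The null set must be chosen before [E], while there are uncountably many self-similar sets.
    Hence the randomness sees only grid systems, indexed by natural numbers, and [E] enters through
    deterministic estimates. A grid system need not consist of similarities nor satisfy the open set
    condition, so no regularity is known for it; the energy bound is therefore a condition inside
    the exceptional event, verified afterwards by comparison with the exact system, whose points are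
    within [2^-n]. The loss from [alpha] to [a'] arises because a point stands for its whole
    [dl]-neighbourhood: a cutting ball of diameter [s] counts only if it contains [B(x, dl)], so its
    centre is confined to radius [s / 2 - dl], which is at least [(1 - 1/K) s / 2] once
    [s >= 2 K dl]. Exponents are rounded to multiples of [1 / (b + 1)]: thresholds become integer
    powers of [tau = 2^(1/(b+1))], and countably many parameters suffice. *)

(** * Euclidean geometry and similarities *)

Section Euclid.
Context {R : realType} {d : nat}.
Notation V := 'rV[R]_d.
Implicit Types x y z : V.

Definition dotv x y : R := \sum_(i < d) x ord0 i * y ord0 i.

Lemma dotvC x y : dotv x y = dotv y x.
Proof. by apply: eq_bigr => i _; rewrite mulrC. Qed.

Lemma dotvDl x y z : dotv (x + y) z = dotv x z + dotv y z.
Proof. by rewrite /dotv -big_split; apply: eq_bigr => i _; rewrite mxE mulrDl. Qed.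

Lemma dotvZl a x y : dotv (a *: x) y = a * dotv x y.
Proof. by rewrite /dotv mulr_sumr; apply: eq_bigr => i _; rewrite mxE mulrA. Qed.

Lemma dotvDr x y z : dotv x (y + z) = dotv x y + dotv x z.
Proof. by rewrite dotvC dotvDl !(dotvC x). Qed.

Lemma dotvZr a x y : dotv x (a *: y) = a * dotv x y.
Proof. by rewrite dotvC dotvZl dotvC. Qed.

Lemma dotvNl x y : dotv (- x) y = - dotv x y.
Proof. by rewrite -scaleN1r dotvZl mulN1r. Qed.

Lemma dotvNr x y : dotv x (- y) = - dotv x y.
Proof. by rewrite dotvC dotvNl dotvC. Qed.

Lemma dotv0l x : dotv 0 x = 0.
Proof. by rewrite -(scale0r x) dotvZl mul0r. Qed.

Lemma dotv_suml (I : Type) (s : seq I) (F : I -> V) x :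
  dotv (\sum_(i <- s) F i) x = \sum_(i <- s) dotv (F i) x.
Proof.
elim: s => [|i s IH]; first by rewrite !big_nil dotv0l.
by rewrite !big_cons dotvDl IH.
Qed.

Lemma dotvv x : dotv x x = enorm x ^+ 2.
Proof.
rewrite /enorm sqr_sqrtr; last by apply: sumr_ge0 => i _; exact: sqr_ge0.
by apply: eq_bigr => i _; rewrite expr2.
Qed.

Lemma enorm_ge0 x : 0 <= enorm x.
Proof. exact: sqrtr_ge0. Qed.

Lemma enorm0 : enorm (0 : V) = 0.
Proof. by apply/eqP; rewrite -sqrf_eq0 -dotvv dotv0l. Qed.

Lemma enormZ a x : enorm (a *: x) = `|a| * enorm x.
Proof.
apply/eqP; rewrite -(@eqrXn2 _ 2) ?mulr_ge0 ?enorm_ge0 //.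
by rewrite -dotvv dotvZl dotvZr dotvv exprMn real_normK ?num_real// expr2 mulrA.
Qed.

Lemma enormN x : enorm (- x) = enorm x.
Proof. by rewrite -scaleN1r enormZ normrN1 mul1r. Qed.

Lemma enormBC x y : enorm (x - y) = enorm (y - x).
Proof. by rewrite -enormN opprB. Qed.

Lemma enorm_coord x i : `|x ord0 i| <= enorm x.
Proof.
rewrite -(@ler_pXn2r _ 2) ?nnegrE ?enorm_ge0 // -dotvv /dotv (bigD1 i) //=.
rewrite real_normK ?num_real // -expr2 lerDl sumr_ge0 // => j _.
by rewrite -expr2 sqr_ge0.
Qed.

Lemma enorm_eq0 x : (enorm x == 0) = (x == 0).
Proof.
apply/eqP/eqP => [h|->]; last exact: enorm0.
apply/rowP => i; rewrite mxE; apply/eqP; rewrite -normr_le0 -h.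
exact: enorm_coord.
Qed.

Lemma dotv_le x y : dotv x y <= enorm x * enorm y.
Proof.
have [/eqP|x0] := eqVneq (enorm x) 0.
  by rewrite enorm_eq0 => /eqP->; rewrite dotv0l enorm0 mul0r.
have [/eqP|y0] := eqVneq (enorm y) 0.
  by rewrite enorm_eq0 => /eqP->; rewrite dotvC dotv0l enorm0 mulr0.
have a0 : 0 < enorm x by rewrite lt_def x0 enorm_ge0.
have b0 : 0 < enorm y by rewrite lt_def y0 enorm_ge0.
have := sqr_ge0 (enorm (enorm y *: x - enorm x *: y)).
rewrite -dotvv !dotvDl !dotvDr !dotvNl !dotvNr !dotvZl !dotvZr !dotvv (dotvC y x).
set c := dotv x y; set a := enorm x; set b := enorm y => h.
have : 0 <= (a * b) * (a * b - c) by nra.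
by rewrite pmulr_rge0 ?mulr_gt0 // subr_ge0.
Qed.

Lemma enormD x y : enorm (x + y) <= enorm x + enorm y.
Proof.
rewrite -(@ler_pXn2r _ 2) ?nnegrE ?addr_ge0 ?enorm_ge0 //.
rewrite -dotvv !dotvDl !dotvDr !dotvv (dotvC y x).
have := dotv_le x y; nra.
Qed.

Lemma enormB_triangle y x z : enorm (x - z) <= enorm (x - y) + enorm (y - z).
Proof. by rewrite -[x - z](subrKA y) enormD. Qed.

Lemma enorm_sum (I : Type) (s : seq I) (F : I -> V) :
  enorm (\sum_(i <- s) F i) <= \sum_(i <- s) enorm (F i).
Proof.
elim: s => [|i s IH]; first by rewrite !big_nil enorm0.
by rewrite !big_cons (le_trans (enormD _ _)) // lerD2l.
Qed.

Lemma enorm_delta (i : 'I_d) : enorm (delta_mx ord0 i : V) = 1.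
Proof.
apply/eqP; rewrite -(@eqrXn2 _ 2) ?enorm_ge0 // expr1n -dotvv /dotv.
rewrite (bigD1 i) //= !mxE !eqxx mulr1 big1 ?addr0 // => j ji.
by rewrite !mxE (negPf ji) andbF mulr0.
Qed.

Lemma enorm_le_sum x : enorm x <= \sum_(i < d) `|x ord0 i|.
Proof.
rewrite {1}[x]row_sum_delta (le_trans (enorm_sum _ (fun i => x ord0 i *: (delta_mx ord0 i : V)))) //.
by apply: ler_sum => i _; rewrite enormZ enorm_delta mulr1.
Qed.

Lemma continuous_enorm (T : topologicalType) (g : T -> V) :
  (forall i, continuous (fun p => g p ord0 i)) -> continuous (fun p => enorm (g p)).
Proof.
move=> h p; rewrite /enorm.
apply: (@continuous_comp _ _ _ (fun p => \sum_(i < d) g p ord0 i ^+ 2) Num.sqrt);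
  last exact: sqrt_continuous.
elim: (index_enum _) => [|i s IH].
  rewrite (_ : (fun _ => _) = fun=> 0); first exact: cvg_cst.
  by apply/funext => q; rewrite big_nil.
rewrite (_ : (fun _ => _) = (fun q => g q ord0 i * g q ord0 i +
    \sum_(j <- s) g q ord0 j ^+ 2)); last first.
  by apply/funext => q; rewrite big_cons expr2.
by apply: continuousD IH; apply: continuousM; exact: h.
Qed.

Lemma enorm_continuousB x : continuous (fun y : V => enorm (y - x)).
Proof.
apply: continuous_enorm => i p.
rewrite (_ : (fun _ => _) = (fun y : V => y ord0 i - x ord0 i)); last first.
  by apply/funext => y; rewrite !mxE.
apply: (@cvgB _ _ _ _ _ (fun y : V => y ord0 i) (fun=> x ord0 i)).
- exact: nbhs_filter.
- exact: coord_continuous.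
- exact: (@cst_continuous V R (x ord0 i) p).
Qed.

Lemma open_eball x (rho : R) : open (eball x rho).
Proof.
have /continuousP h := @enorm_continuousB x.
exact: (h _ (@open_lt _ rho)).
Qed.

Section Similarity.
Variables (f : V -> V) (rho : R).
Hypothesis sf : is_similarity f rho.

Lemma similarity_dotv x y : dotv (f x - f 0) (f y - f 0) = rho ^+ 2 * dotv x y.
Proof.
have polar (u v : V) : dotv u v = (enorm u ^+ 2 + enorm v ^+ 2 - enorm (u - v) ^+ 2) / 2.
  rewrite -(dotvv (u - v)) !dotvDl !dotvDr !dotvNl !dotvNr !dotvv (dotvC v u); lra.
rewrite polar (polar x y).
have -> : f x - f 0 - (f y - f 0) = f x - f y by rewrite opprB addrA subrK.
by rewrite !sf !subr0; ring.
Qed.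

Definition sim_mx : 'M[R]_d := \matrix_(i, j) (f (delta_mx ord0 i) - f 0) ord0 j.

(** By polarisation [f - f 0] multiplies inner products by [rho^2], so expanding the square of
    [|x *m sim_mx - (f x - f 0)|] gives [rho^2 |x|^2 (1 + 1 - 2) = 0]. A similarity is thus given by
    finitely many real parameters, which can be put on a grid. *)
Lemma similarity_affine x : f x = x *m sim_mx + f 0.
Proof.
suff -> : x *m sim_mx = f x - f 0 by rewrite subrK.
set y := x *m sim_mx.
have yE : y = \sum_i x ord0 i *: (f (delta_mx ord0 i) - f 0).
  by apply/rowP => j; rewrite mxE summxE; apply: eq_bigr => i _; rewrite !mxE.
have dotd (u : V) i : dotv (delta_mx ord0 i) u = u ord0 i.
  rewrite /dotv (bigD1 i) //= mxE !eqxx mul1r big1 ?addr0 // => j ji.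
  by rewrite mxE (negPf ji) andbF mul0r.
have doty (u : V) : dotv y (f u - f 0) = rho ^+ 2 * dotv x u.
  rewrite yE dotv_suml /dotv mulr_sumr; apply: eq_bigr => i _.
  by rewrite -/(dotv _ _) dotvZl similarity_dotv dotd; ring.
have yy : dotv y y = rho ^+ 2 * dotv x x.
  rewrite {2}yE dotvC dotv_suml -[dotv x x]/(\sum_i _) mulr_sumr; apply: eq_bigr => i _.
  by rewrite dotvZl dotvC doty (dotvC x) dotd; ring.
apply/eqP; rewrite -subr_eq0 -enorm_eq0 -sqrf_eq0 -dotvv !dotvDl !dotvDr !dotvNl !dotvNr.
by rewrite yy doty (dotvC _ y) doty similarity_dotv; apply/eqP; ring.
Qed.

Lemma similarity_surj : 0 < rho -> forall y, exists x, f x = y.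
Proof.
move=> rho0 y.
have AT : sim_mx *m sim_mx^T = (rho ^+ 2)%:M.
  apply/matrixP => i j; rewrite mxE [RHS]mxE.
  have := similarity_dotv (delta_mx ord0 i) (delta_mx ord0 j).
  rewrite [in RHS]/dotv (bigD1 i) //= !mxE !eqxx mul1r big1 => [|k ki]; last first.
    by rewrite !mxE (negPf ki) mul0r.
  rewrite addr0 => h; rewrite (eq_bigr (fun k => (f (delta_mx ord0 i) - f 0) ord0 k *
      (f (delta_mx ord0 j) - f 0) ord0 k)) => [|k _]; last by rewrite !mxE.
  by rewrite -/(dotv _ _) h mulr_natr.
have : sim_mx *m (rho ^- 2 *: sim_mx^T) = 1%:M.
  rewrite -scalemxAr AT scale_scalar_mx mulVf //.
  by rewrite expf_neq0 // gt_eqF.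
move=> /mulmx1C h; exists ((y - f 0) *m (rho ^- 2 *: sim_mx^T)).
by rewrite similarity_affine -mulmxA h mulmx1 subrK.
Qed.

End Similarity.
End Euclid.

(** * Intensity of void sets *)

Section Void.
Context {R : realType} {d : nat}.
Notation V := 'rV[R]_d.

(* Parameters [(t, s)] of the balls [B(s t, s / 2)] containing the ball [B(x, dl)] with
   [s < rho]. *)
Definition voidset (x : V) (dl rho : R) : set (V * R) :=
  [set p | enorm (p.2 *: p.1 - x) < p.2 / 2 - dl /\ p.2 < rho].

Lemma open_voidset x dl rho : open (voidset x dl rho).
Proof.
have cs : continuous (fun p : V * R => p.2) by move=> p; exact: cvg_snd.
have c1 : continuous (fun p : V * R => enorm (p.2 *: p.1 - x)).
  apply: continuous_enorm => i p.
  rewrite (_ : (fun _ => _) = (fun p : V * R => p.2 * p.1 ord0 i - x ord0 i)); last first.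
    by apply/funext => y; rewrite !mxE.
  apply: (@continuousB _ _ _ (fun p : V * R => p.2 * p.1 ord0 i) (fun=> x ord0 i)).
    apply: continuousM; first exact: cs.
    apply: (@continuous_comp _ _ _ fst (fun y : V => y ord0 i)); first exact: cvg_fst.
    exact: coord_continuous.
  exact: cst_continuous.
have c2 : continuous (fun p : V * R => p.2 / 2 - dl).
  move=> p.
  apply: (@continuousB _ _ _ (fun p : V * R => p.2 / 2) (fun=> dl)).
    apply: (@continuousM _ _ (fun p : V * R => p.2) (fun=> 2^-1)); first exact: cs.
    exact: cst_continuous.
  exact: cst_continuous.
have -> : voidset x dl rho =
    [set p | 0 < (p.2 / 2 - dl) - enorm (p.2 *: p.1 - x)] `&` [set p | p.2 < rho].
  by apply/seteqP; split => p /=; rewrite subr_gt0.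
apply: openI.
  have /continuousP h : continuous (fun p : V * R => (p.2 / 2 - dl) - enorm (p.2 *: p.1 - x)).
    move=> p; apply: (@continuousB _ _ _ (fun p : V * R => p.2 / 2 - dl)
      (fun p : V * R => enorm (p.2 *: p.1 - x))); [exact: c2 | exact: c1].
  exact: (h _ (@open_gt _ 0)).
have /continuousP h := cs.
exact: (h _ (@open_lt _ rho)).
Qed.

Lemma borel_voidset x dl rho : borel_pair (voidset x dl rho).
Proof. by apply: sub_sigma_algebra; exact: open_voidset. Qed.

(** A ball of diameter below [rho] cannot contain two points at distance [rho]. As [rho'] is free,
    it suffices in a list to truncate each radius by the distances to later points. *)
Lemma disjoint_voidset x y dl rho rho' : 0 < dl -> rho <= enorm (x - y) ->
  voidset x dl rho `&` voidset y dl rho' = set0.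
Proof.
move=> dl0 h; apply/seteqP; split => // p [] [h1 h2] [h3 h4] /=.
have := enormB_triangle (p.2 *: p.1) x y.
rewrite (enormBC x (_ *: _)); lra.
Qed.

(** Scaling is carried out on covers, since [lebd] is an infimum over them: [t -> (t - y) / c] turns
    the given cover into one of the ball of diameter one. *)
Lemma lebd_eball_cover (c : R) (y : V) (a b : nat -> 'I_d -> R) : 0 < c ->
  (forall k i, a k i <= b k i) -> eball y (c / 2) `<=` \bigcup_k box (a k) (b k) ->
  ((c ^+ d)%:E * lebd (eball (0 : V) 2^-1) <= \sum_(k <oo) (boxvol (a k) (b k))%:E)%E.
Proof.
move=> c0 ab cov.
pose a' k i := (a k i - y ord0 i) / c; pose b' k i := (b k i - y ord0 i) / c.
have vol k : boxvol (a k) (b k) = c ^+ d * boxvol (a' k) (b' k).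
  rewrite /boxvol /a' /b' -[in c ^+ d](card_ord d) -prodr_const -big_split /=.
  by apply: eq_bigr => i _; field; rewrite gt_eqF.
have ab' k i : a' k i <= b' k i by rewrite ler_pM2r ?invr_gt0 // lerB.
have vol0 k : (0 <= (boxvol (a' k) (b' k))%:E)%E.
  by rewrite lee_fin prodr_ge0 // => i _; rewrite subr_ge0.
rewrite (eq_eseriesr (g := fun k => ((c ^+ d)%:E * (boxvol (a' k) (b' k))%:E)%E)); last first.
  by move=> k _; rewrite vol EFinM.
rewrite nneseriesZl //; apply: lee_pmul => //.
- by rewrite lee_fin exprn_ge0 // ltW.
- apply/ereal_infP => _ [a1 [b1 [h1 [_ ->]]]].
  apply: nneseries_ge0 => k _ _; rewrite lee_fin prodr_ge0 // => i _.
  by rewrite subr_ge0.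
apply: ereal_inf_lbound; exists a', b'; split => //; split => // x xb.
have : eball y (c / 2) (c *: x + y).
  rewrite /eball /= addrK enormZ gtr0_norm // ltr_pM2l //.
  by move: xb; rewrite /eball /= subr0.
move=> /cov [k _ kx]; exists k => // i; move: (kx i); rewrite !mxE /a' /b'.
by rewrite ler_pdivrMr // ltr_pdivlMr // lerBlDr ltrBrDr mulrC.
Qed.

(** Each cover is bounded separately. At every height [s] in [[2 K dl, rho)] the slice of the void
    set contains a ball of radius [(1 - 1/K) / 2], so the boxes active at that height have total
    volume at least [(1 - 1/K)^d L]. Integrating over the heights and exchanging sum and integral
    bounds the cost of the cover from below. *)
Lemma intensity_voidset (r alpha K dl rho : R) x :
  (0 < d)%N -> 0 < r -> 0 < alpha ->
  alpha%:E = (r%:E * lebd (eball (0 : V) 2^-1))%E ->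
  1 < K -> 0 < dl -> 2 * K * dl < rho ->
  (((1 - K^-1) ^+ d * alpha * ln (rho / (2 * K * dl)))%:E <=
     intensity r (voidset x dl rho))%E.
Proof.
move=> d0 r0 al0 alE K1 dl0 hrho; set sg := 2 * K * dl.
have K0 : 0 < K by lra.
have sg0 : 0 < sg by rewrite /sg !mulr_gt0.
have rho0 : 0 < rho := lt_trans sg0 hrho.
set c := 1 - K^-1.
have c0 : 0 < c by rewrite subr_gt0 invf_lt1.
have [L LE] : exists L, lebd (eball (0 : V) 2^-1) = L%:E.
  case: (lebd _) alE => [L||]; first by exists L.
    by rewrite gt0_muley // lte_fin.
  by rewrite gt0_muleNy // lte_fin.
have al : alpha = r * L by move: alE; rewrite LE -EFinM => -[].
apply/ereal_infP => _ [a [b [c1 [e1 [ab [ce [cov ->]]]]]]].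
have vol0 k : 0 <= boxvol (a k) (b k).
  by apply: prodr_ge0 => i _; rewrite subr_ge0.
have c10 k : 0 < c1 k by have /andP[] := ce k.
have e10 k : 0 < e1 k by have /andP[] := ce k; exact: lt_le_trans.
(* In the variable [u = ln s] the measure [ds / s] becomes Lebesgue measure. *)
pose I k := `[ln (c1 k), ln (e1 k)[%classic : set (measurableTypeR R).
pose f k (u : measurableTypeR R) : \bar R := (boxvol (a k) (b k) * \1_(I k) u)%:E.
pose D := `[ln sg, ln rho[%classic : set (measurableTypeR R).
have slice u : D u -> ((c ^+ d * L)%:E <= \sum_(k <oo) f k u)%E.
  rewrite /D /= in_itv /= => /andP[u1 u2].
  set s := expR u.
  have s0 : 0 < s by exact: expR_gt0.
  have s1 : sg <= s by rewrite -ler_ln ?posrE // expRK.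
  have s2 : s < rho by rewrite -ltr_ln ?posrE // expRK.
  have inI k : \1_(I k) u = (c1 k <= s < e1 k)%R%:R :> R.
    by rewrite indicE /I mem_setE in_itv /= -(expRK u) -/s ler_ln ?posrE // ltr_ln ?posrE.
  (* Boxes absent from this slice are made degenerate, so that the cover stays indexed by all [k];
     their volume vanishes because [d > 0]. *)
  pose b' k := if c1 k <= s < e1 k then b k else a k.
  have volE k : boxvol (a k) (b' k) = boxvol (a k) (b k) * (c1 k <= s < e1 k)%R%:R.
    rewrite /b'; case: ifP => _; first by rewrite mulr1.
    by rewrite mulr0 /boxvol (bigD1 (Ordinal d0)) //= subrr mul0r.
  rewrite EFinM -LE.
  rewrite (eq_eseriesr (g := fun k => (boxvol (a k) (b' k))%:E)); last first.
    by move=> k _; rewrite /f volE inI.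
  apply: (@lebd_eball_cover _ (s^-1 *: x)) => //.
    by move=> k i; rewrite /b'; case: ifP.
  move=> t ht.
  have vt : voidset x dl rho (t, s).
    split => //=; move: ht; rewrite /eball /= => ht.
    have -> : s *: t - x = s *: (t - s^-1 *: x).
      by rewrite scalerBr scalerA divff ?scale1r // gt_eqF.
    rewrite enormZ gtr0_norm //.
    have : s * enorm (t - s^-1 *: x) < s * (c / 2) by rewrite ltr_pM2l.
    move=> /lt_le_trans; apply.
    have : dl <= s * (K^-1 / 2).
      apply: le_trans (ler_wpM2r _ s1); first by rewrite /sg le_eqVlt; apply/orP; left; apply/eqP; field; lra.
      by rewrite mulr_ge0 // invr_ge0 ltW.
    rewrite /c; lra.
  have [k _ /= [kb ks]] := cov (t, s) (conj vt s0).
  by exists k => // i; rewrite /b' ks; exact: kb.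
have mI k : measurable (I k) by exact: measurable_itv.
have mf k (E : set (measurableTypeR R)) : measurable_fun E (f k).
  apply/measurable_EFinP; apply: measurable_funM => //.
have f0 k u : (0 <= f k u)%E by rewrite lee_fin mulr_ge0 // indicE ler0n.
have intf k : (\int[lebesgue_measure]_(u in D) f k u <= (boxvol (a k) (b k) * ln (e1 k / c1 k))%:E)%E.
  apply: (@le_trans _ _ (\int[lebesgue_measure]_(u in [set: measurableTypeR R]) f k u)%E).
    apply: ge0_subset_integral => //; exact: measurable_itv.
  rewrite /f; under eq_integral do rewrite EFinM.
  have h1 : measurable_fun [set: measurableTypeR R] (fun u => (\1_(I k) u)%:E : \bar R).
    by apply/measurable_EFinP.
  rewrite ge0_integralZl ?lee_fin //.
  rewrite integral_indic // setIT EFinM; apply: lee_pmul => //; first by rewrite lee_fin.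
  change (lebesgue_measure (I k) <= (ln (e1 k / c1 k))%:E)%E.
  have -> : lebesgue_measure (I k) =
      (if (ln (c1 k) < ln (e1 k))%R then (ln (e1 k))%:E - (ln (c1 k))%:E else 0)%E.
    by rewrite lebesgue_measure_itv /= lte_fin.
  rewrite ln_div ?posrE //; case: ifPn => h; first by rewrite -EFinD.
  by rewrite lee_fin subr_ge0 ler_ln ?posrE //; have /andP[] := ce k.
have cL0 : 0 <= c ^+ d * L.
  have : 0 <= alpha * (c ^+ d) by rewrite mulr_ge0 ?exprn_ge0 // ltW.
  by rewrite al -mulrA pmulr_rge0 // mulrC.
have main : ((c ^+ d * L * ln (rho / sg))%:E <= \sum_(k <oo) (boxvol (a k) (b k) * ln (e1 k / c1 k))%:E)%E.
  apply: (@le_trans _ _ (\int[lebesgue_measure]_(u in D) (c ^+ d * L)%:E)%E).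
    have muD : lebesgue_measure D = ((ln rho)%:E - (ln sg)%:E)%E.
      by rewrite lebesgue_measure_itv /= lte_fin ltr_ln ?posrE // hrho.
    have -> : (\int[lebesgue_measure]_(u in D) (c ^+ d * L)%:E =
        (c ^+ d * L)%:E * lebesgue_measure D)%E by rewrite integral_cst //; exact: measurable_itv.
    by rewrite muD -EFinD ln_div ?posrE // -EFinM.
  apply: (@le_trans _ _ (\int[lebesgue_measure]_(u in D) \sum_(k <oo) f k u)%E).
    apply: ge0_le_integral.
    - exact: measurable_itv.
    - by move=> u _; rewrite lee_fin.
    - exact: measurable_cst.
    - apply: (@ge0_emeasurable_sum _ _ _ D f xpredT) => [k u _ _|k _]; [exact: f0|exact: mf].
    - exact: slice.
  have -> : (\int[lebesgue_measure]_(u in D) \sum_(k <oo) f k u =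
      \sum_(k <oo) \int[lebesgue_measure]_(u in D) f k u)%E.
    by apply: integral_nneseries => //; exact: measurable_itv.
  apply: lee_nneseries => [k _ _|k _]; first exact: integral_ge0.
  exact: intf.
rewrite (eq_eseriesr (g := fun k => (r%:E * (boxvol (a k) (b k) * ln (e1 k / c1 k))%:E)%E)); last first.
  by move=> k _; rewrite -EFinM mulrA.
rewrite nneseriesZl //; last first.
  move=> k _; rewrite lee_fin mulr_ge0 // ln_ge0 // ler_pdivlMr // mul1r.
  by have /andP[] := ce k.
have -> : c ^+ d * alpha * ln (rho / sg) = r * (c ^+ d * L * ln (rho / sg)) by rewrite al; ring.
by rewrite EFinM lee_pmul2l // lte_fin.
Qed.

End Void.

(** * Moments of the number of void points *)

Section Moments.
Context {R : realType} {d : nat}.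
Notation V := 'rV[R]_d.
Variables (g : R -> R).

Definition mindist (x : V) (xs : seq V) : R := \big[Num.min/1]_(y <- xs) enorm (x - y).

Fixpoint wt (xs : seq V) : R := if xs is x :: s then g (mindist x s) * wt s else 1.

Lemma mindist_le1 x xs : mindist x xs <= 1.
Proof.
rewrite /mindist; elim: xs => [|y s IH]; first by rewrite big_nil.
by rewrite big_cons ge_min IH orbT.
Qed.

Lemma mindist_le x xs y : y \in xs -> mindist x xs <= enorm (x - y).
Proof.
rewrite /mindist; elim: xs => // z s IH; rewrite in_cons big_cons ge_min.
by case/orP => [/eqP->|/IH ->]; rewrite ?lexx ?orbT.
Qed.

Lemma wtE xs :
  wt xs = \prod_(i < size xs) g (mindist (nth 0 xs i) (drop i.+1 xs)).
Proof.
elim: xs => [|x s IH] /=; first by rewrite big_ord0.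
by rewrite big_ord_recl /= drop0 IH.
Qed.

Hypothesis g0 : forall u, 0 <= g u.

Lemma wt_ge0 xs : 0 <= wt xs.
Proof. by elim: xs => [|x s IH] //=; rewrite mulr_ge0. Qed.

Lemma g_mindist x xs : g (mindist x xs) <= g 1 + \sum_(y <- xs) g (enorm (x - y)).
Proof.
rewrite /mindist; elim: xs => [|y s IH]; first by rewrite !big_nil addr0.
rewrite !big_cons /Num.min; case: ifP => _.
  by rewrite addrCA lerDl addr_ge0 // sumr_ge0.
by rewrite addrCA (le_trans IH) // lerDr.
Qed.

Context {dO : measure_display} {Omega : measurableType dO}.
Variable (P : probability Omega R) (A : V -> set Omega).
Hypothesis mA : forall x, measurable (A x).

Definition allA (xs : seq V) : set Omega := [set w | forall x, x \in xs -> A x w].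

Hypothesis PA : forall xs, (P (allA xs) <= (wt xs)%:E)%E.

Definition countA (X : seq V) (w : Omega) : R := \sum_(x <- X) \1_(A x) w.

Lemma allA_cons x xs : allA (x :: xs) = A x `&` allA xs.
Proof.
apply/seteqP; split => w /= h.
  by split; [apply: h; rewrite mem_head | move=> y ys; apply: h; rewrite in_cons ys orbT].
by move=> y; rewrite in_cons => /orP[/eqP->|]; [exact: h.1 | exact: h.2].
Qed.

Lemma measurable_allA xs : measurable (allA xs).
Proof.
elim: xs => [|x xs IH]; last by rewrite allA_cons; exact: measurableI.
by rewrite (_ : allA [::] = setT) //; apply/seteqP; split.
Qed.

Lemma measurable_countA X : measurable_fun setT (countA X).
Proof.
rewrite /countA; elim: X => [|x X IH].
  by under eq_fun do rewrite big_nil; exact: measurable_cst.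
under eq_fun do rewrite big_cons.
by apply: measurable_funD.
Qed.

Lemma countA_ge0 X w : 0 <= countA X w.
Proof. by apply: sumr_ge0 => x _; rewrite indicE ler0n. Qed.

Variables (X : seq V) (G : R).
Hypothesis G1 : \sum_(x <- X) g 1 <= G.
Hypothesis GX : forall y, y \in X -> \sum_(x <- X) g (enorm (x - y)) <= G.

Let G0 : 0 <= G.
Proof. by apply: le_trans G1; exact: sumr_ge0. Qed.

(** The minimum is 1 or one of the distances to [xs], so [g] of it is at most the sum over all these
    candidates; each candidate costs [G] after summation over [X]. *)
Lemma sum_g_mindist xs : {subset xs <= X} ->
  \sum_(x <- X) g (mindist x xs) <= (size xs).+1%:R * G.
Proof.
move=> sX; apply: (@le_trans _ _ (\sum_(x <- X) (g 1 + \sum_(y <- xs) g (enorm (x - y))))).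
  by apply: ler_sum => x _; exact: g_mindist.
rewrite big_split /= -natr1 addrC mulrDl mul1r; apply: lerD => //.
rewrite exchange_big /= -[size xs]count_predT -sum1_count natr_sum mulr_suml.
rewrite big_seq [leRHS]big_seq; apply: ler_sum => y /sX yX.
by rewrite mul1r; exact: GX.
Qed.

(** One factor of the power is expanded at a time: the indicator of [allA xs] times [countA X] is
    the sum over [x] in [X] of the indicators of [allA (x :: xs)]. The list [xs] holds the points
    already chosen; summing the new weight over [X] costs [(size xs + 1) G]. *)
Lemma moment_bound q xs : {subset xs <= X} ->
  (\int[P]_w (\1_(allA xs) w * countA X w ^+ q)%:E <=
     (wt xs * \prod_(i < q) ((size xs + i).+1%:R * G))%:E)%E.
Proof.
elim: q xs => [|q IH] xs sX.
  rewrite big_ord0 mulr1; apply: le_trans (PA xs).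
  under eq_integral do rewrite expr0 mulr1.
  by rewrite integral_indic ?setIT //; exact: measurable_allA.
have mf ys p : measurable_fun setT (fun w => (\1_(allA ys) w * countA X w ^+ p)%:E : \bar R).
  apply/measurable_EFinP; apply: measurable_funM.
    exact/measurable_indic/measurable_allA.
  by apply: measurable_funX; exact: measurable_countA.
have E w : (\1_(allA xs) w * countA X w ^+ q.+1)%:E =
    (\sum_(x <- X) (\1_(allA (x :: xs)) w * countA X w ^+ q)%:E)%E.
  rewrite sumEFin -mulr_suml exprS mulrA; congr ((_ * _)%:E).
  rewrite mulr_sumr; apply: eq_bigr => x _.
  by rewrite allA_cons indicI /= mulrC.
under eq_integral do rewrite E.
rewrite ge0_integral_sum //; last first.
  by move=> x w _; rewrite lee_fin mulr_ge0 ?exprn_ge0 ?countA_ge0 // indicE ler0n.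
apply: (@le_trans _ _ (\sum_(x <- X) (g (mindist x xs) * wt xs * \prod_(i < q) (((size xs).+1 + i).+1%:R * G))%:E)%E).
  rewrite big_seq [leRHS]big_seq; apply: lee_sum => x xX; apply: IH => y.
  by rewrite in_cons => /orP[/eqP->|/sX].
rewrite sumEFin lee_fin -!mulr_suml big_ord_recl addn0 mulrA.
rewrite (eq_bigr (fun i : 'I_q => (size xs + bump 0 i).+1%:R * G)); last first.
  by move=> i _; rewrite /bump /= addSnnS.
apply: ler_wpM2r; first by apply: prodr_ge0 => i _; rewrite mulr_ge0.
by rewrite mulrC ler_wpM2l ?wt_ge0 // sum_g_mindist.
Qed.

(** Markov's inequality for the [q]-th power; starting from the empty list, the moment bound is
    [q! G^q]. *)
Lemma count_tail (L : R) q : 0 < L ->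
  (P [set w | L <= countA X w]%R <= (q`!%:R * (G / L) ^+ q)%:E)%E.
Proof.
move=> L0.
have mE : measurable [set w | L <= countA X w].
  rewrite -[X in measurable X]setTI -[X in _ `&` X]/(countA X @^-1` [set u | L <= u]).
  have -> : [set u | L <= u] = `[L, +oo[%classic by apply/seteqP; split => u /=; rewrite in_itv /= andbT.
  by apply: measurable_countA => //; exact: measurable_itv.
have := @moment_bound q [::] _; rewrite mul1r => /(_ (fun x => ltac:(by [])))  h.
have : ((L ^+ q)%:E * P [set w | L <= countA X w]%R <= (\prod_(i < q) (i.+1%:R * G))%:E)%E.
  apply: le_trans h.
  rewrite -(setIT [set w | L <= countA X w]) -integral_indic //.
  have mI : measurable_fun setT (fun w => (\1_[set w | (L <= countA X w)%R] w)%:E : \bar R).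
    by apply/measurable_EFinP.
  rewrite -ge0_integralZl ?lee_fin ?exprn_ge0 ?(ltW L0) //.
  apply: ge0_le_integral => //.
  - by move=> w _; rewrite -EFinM lee_fin mulr_ge0 ?exprn_ge0 ?(ltW L0) // indicE ler0n.
  - by apply: measurable_funeM; apply/measurable_EFinP.
  - apply/measurable_EFinP; apply: measurable_funM.
      exact/measurable_indic/measurable_allA.
    by apply: measurable_funX; exact: measurable_countA.
  move=> w _; rewrite -EFinM lee_fin !indicE (mem_set (_ : allA [::] w)) // mul1r.
  case: (boolP (w \in _)) => [|_]; last by rewrite mulr0 exprn_ge0 // countA_ge0.
  by rewrite inE /= => hL; rewrite mulr1 lerXn2r // nnegrE ?countA_ge0 // ltW.
rewrite big_split /= prodr_const card_ord -natr_prod -(big_mkord xpredT succn).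
rewrite -(big_add1 _ _ 0 q.+1 xpredT id) -fact_prod => h2.
rewrite expr_div_n mulrA [_ / _]mulrC EFinM.
by rewrite lee_pdivlMl // exprn_gt0.
Qed.

End Moments.

(** * Void probabilities of the Poisson process *)

Section VoidEvents.
Context {R : realType} {d : nat}.
Notation V := 'rV[R]_d.

(** The intensity estimate starts at [sg = 2 K dl]; for smaller radii only the trivial bound 1 is
    available. *)
Definition gdec (sg a rho : R) : R := if rho <= sg then 1 else (sg / rho) `^ a.

Lemma gdec_ge0 sg a rho : 0 <= gdec sg a rho.
Proof. by rewrite /gdec; case: ifP => // _; exact: powR_ge0. Qed.

Context {dO : measure_display} {Omega : measurableType dO}.
Variables (P : probability Omega R) (Y : Omega -> set (V * R)).
Variables (r alpha K dl : R).
Hypotheses (YP : is_PPP P Y r) (d0 : (0 < d)%N) (r0 : 0 < r) (alpha0 : 0 < alpha).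
Hypothesis alphaE : alpha%:E = (r%:E * lebd (eball (0 : V) 2^-1))%E.
Hypotheses (K1 : 1 < K) (dl0 : 0 < dl).

Let K0 : 0 < K. Proof. by rewrite (lt_trans ltr01). Qed.

Definition void_event (x : V) (rho : R) : set Omega := count_event Y (voidset x dl rho) (Some 0%N).

Let ga := gdec (2 * K * dl) ((1 - K^-1) ^+ d * alpha).

Lemma measurable_void x rho : measurable (void_event x rho).
Proof. by case: YP => _ [h _]; apply: h; exact: borel_voidset. Qed.

Lemma void_prob x rho : (P (void_event x rho) <= (ga rho)%:E)%E.
Proof.
rewrite /ga /gdec; case: (leP rho) => hrho; first by apply: probability_le1; exact: measurable_void.
have sg0 : 0 < 2 * K * dl by rewrite !mulr_gt0.
have rho0 : 0 < rho by exact: lt_trans hrho.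
have := intensity_voidset x d0 r0 alpha0 alphaE K1 dl0 hrho.
case: YP => _ [mc [+ _]].
move=> /(_ _ (borel_voidset x dl rho)); case: intensity => [lam||] //.
- move=> /(_ 0%N) h; rewrite lee_fin => hl.
  rewrite /void_event h lee_fin /ppmf expr0 fact0 divr1 mul1r /powR.
  rewrite gt_eqF ?divr_gt0 // ler_expR.
  have -> : ln (2 * K * dl / rho) = - ln (rho / (2 * K * dl)).
    by rewrite !ln_div ?posrE // opprB.
  by rewrite mulrN lerN2.
(* With infinite intensity the count is almost surely infinite, and the void event is disjoint from
   that. *)
- move=> hP _; apply: (@le_trans _ _ 0%E); last by rewrite lee_fin powR_ge0.
  have : (P (void_event x rho) + P (count_event Y (voidset x dl rho) None) <= 1)%E.
    have m1 k : measurable (count_event Y (voidset x dl rho) k).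
      by apply: mc; exact: borel_voidset.
    have dj : void_event x rho `&` count_event Y (voidset x dl rho) None = set0.
      by apply/seteqP; split => // w [] /= h1 h2; apply: h2; exists 0%N.
    rewrite -measureU //; last exact: m1.
    by apply: probability_le1; apply: measurableU; exact: m1.
  by rewrite hP -leeBrDr // subee.
Qed.

Lemma void_le x rho rho' : rho <= rho' -> void_event x rho' `<=` void_event x rho.
Proof.
move=> h w; rewrite /void_event /count_event /= !II0 !card_eq0 => /eqP h0; apply/eqP.
apply/seteqP; split => // p [Yp [h1 h2]]; rewrite -h0; split => //; split => //.
exact: lt_le_trans h2 h.
Qed.

(* The truncated radii [mindist] make the void sets of the points of [xs] disjoint, hence
   their void events independent. *)
Lemma void_wt xs : (P (allA (fun x => void_event x 1%R) xs) <= (wt ga xs)%:E)%E.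
Proof.
pose rh (i : 'I_(size xs)) := mindist (nth 0 xs i) (drop i.+1 xs).
pose S (i : 'I_(size xs)) := voidset (nth 0 xs i) dl (rh i).
have dis (i j : 'I_(size xs)) : (i < j)%N -> S i `&` S j = set0.
  move=> ij; apply: disjoint_voidset => //; apply: mindist_le.
  have -> : nth 0 xs j = nth 0 (drop i.+1 xs) (j - i.+1)%N by rewrite nth_drop subnKC.
  by apply: mem_nth; rewrite size_drop ltn_sub2r // (leq_ltn_trans ij).
have [_ [mc [_ /(_ (size xs) S (fun=> Some 0%N)) ind]]] := YP.
have {}ind : P [set w | forall i, void_event (nth 0 xs (i : 'I_(size xs))) (rh i) w] =
    (\prod_(i < size xs) P (void_event (nth 0%R xs i) (rh i)))%E.
  apply: ind => [i|i j]; first exact: borel_voidset.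
  by case: (ltngtP i j) => [ij|ji|/val_inj->]; rewrite ?eqxx // => _; [|rewrite setIC]; exact: dis.
apply: (@le_trans _ _ (P [set w | forall i, void_event (nth 0 xs (i : 'I_(size xs))) (rh i) w])).
  apply: le_measure; rewrite ?inE.
  - exact: (measurable_allA (fun x => measurable_void x 1)).
  - rewrite (_ : mkset _ = \bigcap_(i in [set: 'I_(size xs)]) void_event (nth 0 xs i) (rh i)).
      by apply: fin_bigcap_measurable => // i _; exact: measurable_void.
    by apply/seteqP; split => w /= h i //; exact: h.
  - move=> w h i; apply: (@void_le _ _ 1); first exact: mindist_le1.
    by apply: h; exact: mem_nth.
rewrite ind wtE -prodEFin.
suff /andP[] : (0 <= \prod_(i < size xs) P (void_event (nth 0%R xs i) (rh i)) <=
    \prod_(i < size xs) (ga (rh i))%:E)%E by [].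
elim/big_ind2: _ => [|p1 q1 p2 q2 /andP[h1 h2] /andP[h3 h4]|i _].
- by rewrite lexx lee01.
- by rewrite mule_ge0 // lee_pmul.
- by rewrite measure_ge0 void_prob.
Qed.

End VoidEvents.

(** * Almost sure bounds uniform over exponentially large families *)

Section BorelCantelli.
Context {R : realType} {d : nat}.
Notation V := 'rV[R]_d.
Context {dO : measure_display} {Omega : measurableType dO}.

Lemma measure_bigsetU_le (mu : {measure set Omega -> \bar R}) (I : Type) (s : seq I)
    (F : I -> set Omega) : (forall i, measurable (F i)) ->
  (mu (\big[setU/set0]_(i <- s) F i) <= \sum_(i <- s) mu (F i))%E.
Proof.
move=> mF; elim: s => [|i s IH]; first by rewrite !big_nil measure0.
rewrite !big_cons; apply: le_trans (measureU2 _ _ _) _ => //.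
  exact: bigsetU_measurable.
by rewrite leeD2l.
Qed.

Variables (P : probability Omega R) (Y : Omega -> set (V * R)).
Variables (r alpha K : R).
Hypotheses (YP : is_PPP P Y r) (d0 : (0 < d)%N) (r0 : 0 < r) (alpha0 : 0 < alpha).
Hypothesis alphaE : alpha%:E = (r%:E * lebd (eball (0 : V) 2^-1))%E.
Hypothesis K1 : 1 < K.

Definition gn (n : nat) : R -> R := gdec (2 * K * 2 ^- n) ((1 - K^-1) ^+ d * alpha).

(* [gn n] dominates the probability of a void event, see [void_prob]; the sums below are
   the discrete energies controlling all moments of the number of void points of [X]. *)
Definition Gbounded (n : nat) (X : seq V) (G : R) : Prop :=
  \sum_(x <- X) gn n 1 <= G /\
  forall y, y \in X -> \sum_(x <- X) gn n (enorm (x - y)) <= G.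

Definition nvoid (n : nat) : seq V -> Omega -> R :=
  countA (fun x => void_event Y (2 ^- n) x 1).

Lemma nvoid_tail n X G L q : Gbounded n X G -> 0 < L ->
  (P [set w | L <= nvoid n X w]%R <= (q`!%:R * (G / L) ^+ q)%:E)%E.
Proof.
have dl0 : 0 < 2 ^- n :> R by rewrite invr_gt0 exprn_gt0.
move=> [G1 G2] L0; apply: (count_tail (g := gn n)) => //.
- by move=> u; exact: gdec_ge0.
- by move=> x; exact: (measurable_void _ YP).
- exact: (void_wt YP d0 r0 alpha0 alphaE K1 dl0).
Qed.

Lemma measurable_nvoid n X L : measurable [set w | L <= nvoid n X w].
Proof.
rewrite -[X in measurable X]setTI -[X in _ `&` X]/(nvoid n X @^-1` [set u | L <= u]).
have -> : [set u | L <= u] = `[L, +oo[%classic by apply/seteqP; split => u /=; rewrite in_itv /= andbT.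
have mc : measurable_fun setT (nvoid n X).
  by apply: measurable_countA => x; exact: (measurable_void _ YP).
by apply: mc => //; exact: measurable_itv.
Qed.

(** Exceeding the energy by a factor [tau^n] has probability at most [q! tau^(-n q)], with [q] at
    disposal. Members that violate the energy bound contribute the empty event, so the family need
    not be restricted beforehand. *)
Lemma nvoid_borel_cantelli (Fam : nat -> finType) (X : forall n, Fam n -> seq V)
    (C M a b : nat) (tau : R) :
  (forall n, #|Fam n| <= C * 2 ^ (M * n))%N -> 0 < tau -> tau ^+ b = 2 ->
  exists N : set Omega, measurable N /\ P N = 0%E /\ forall w, ~ N w ->
    exists n0, forall n (p : Fam n), (n0 <= n)%N -> Gbounded n (X n p) (tau ^+ (n * a)) ->
      nvoid n (X n p) w < tau ^+ (n * a.+1).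
Proof.
move=> cF tau0 tauE.
pose bad1 n p := if `[< Gbounded n (X n p) (tau ^+ (n * a)) >]
  then [set w | tau ^+ (n * a.+1) <= nvoid n (X n p) w] else set0.
pose bad n := \big[setU/set0]_(p : Fam n) bad1 n p.
have mb1 n p : measurable (bad1 n p).
  by rewrite /bad1; case: ifP => _; [exact: measurable_nvoid | exact: measurable0].
have mb n : measurable (bad n) by apply: bigsetU_measurable => p _; exact: mb1.
(* Since [tau^b = 2], this order gives [tau^(-n q) = 2^(-n (M + 1))], and the union bound over
   [C 2^(M n)] members leaves a multiple of [2^-n]. *)
pose q := (b * M.+1)%N.
have Pb n : (P (bad n) <= ((2 * C * q`!)%:R / (2 ^ (n + 1))%:R)%:E)%E.
  apply: le_trans (measure_bigsetU_le _ _ (mb1 n)) _.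
  apply: (@le_trans _ _ (\sum_(p : Fam n) (q`!%:R * (2 ^- (n * M.+1)))%:E)%E).
    apply: lee_sum => p _; rewrite /bad1; case: ifPn => [/asboolP h|_]; last first.
      by rewrite measure0 lee_fin mulr_ge0 // invr_ge0 exprn_ge0.
    apply: le_trans (nvoid_tail q h _) _; first by rewrite exprn_gt0.
    rewrite lee_fin ler_wpM2l // le_eqVlt; apply/orP; left; apply/eqP.
    have -> : tau ^+ (n * a) / tau ^+ (n * a.+1) = tau ^- n.
      by rewrite mulnS exprD invfM mulrCA divff ?mulr1 // gt_eqF ?exprn_gt0.
    by rewrite exprVn -exprM /q mulnCA exprM tauE.
  rewrite sumEFin lee_fin sumr_const -[leLHS]mulr_natl.
  apply: (@le_trans _ _ ((C * 2 ^ (M * n))%:R * (q`!%:R * 2 ^- (n * M.+1)))).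
    by rewrite ler_wpM2r ?ler_nat // mulr_ge0 // invr_ge0 exprn_ge0.
  rewrite le_eqVlt; apply/orP; left; apply/eqP.
  rewrite mulnS exprD !natrM !natrX exprD [(n * M)%N]mulnC expr1; field.
  by rewrite !expf_neq0.
exists (lim_sup_set bad); split; [|split].
- by apply: bigcapT_measurable => n; apply: bigcup_measurable => k _.
- apply: lim_sup_set_cvg0 => //.
  have hc := @cvg_geometric_eseries_half R (2 * C * q`!)%:R 0.
  apply: (@le_lt_trans _ _ (\sum_(n <oo) ((2 * C * q`!)%:R / (2 ^ (n + 1))%:R)%:E)%E).
    by apply: lee_nneseries => n _ //; exact: Pb.
  by rewrite (cvg_lim _ hc) // ltry.
move=> w hw; apply: contrapT => h; apply: hw => n _.
apply: contrapT => h2; apply: h; exists n => k p nk hG.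
rewrite ltNge; apply/negP => hL; apply: h2; exists k => //.
rewrite /bad -(bigcup_seq (index_enum (Fam k)) (bad1 k)); exists p => /=.
  by rewrite mem_index_enum.
by rewrite /bad1 asboolT.
Qed.

End BorelCantelli.

(** * Words and the open set condition *)

Section Packing.
Context {R : realType} {d : nat}.
Notation V := 'rV[R]_d.

(** Pigeonhole on cubes of side [s / (d + 1)]: two points in one cube are at distance at most
    [d s / (d + 1) < s], and [2 D (d + 1) + 1] cubes per axis suffice. *)
Lemma separated_points_le (I : eqType) (l : seq I) (p : I -> V) (y : V) (s : R) (D : nat) :
  0 < s -> uniq l ->
  {in l &, forall i j, i != j -> s <= enorm (p i - p j)} ->
  {in l, forall i, enorm (p i - y) <= D%:R * s} ->
  (size l <= ((2 * D * d.+1).+1) ^ d)%N.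
Proof.
move=> s0 ul sep near; set N := (2 * D * d.+1)%N.
pose h := s / d.+1%:R.
have h0 : 0 < h by rewrite divr_gt0.
pose co (x : V) (i : 'I_d) : R := (x ord0 i - y ord0 i + D%:R * s) / h.
pose cell x : {ffun 'I_d -> 'I_N.+1} := [ffun i => inord (Num.truncn (co x i))].
have coN i c : i \in l -> 0 <= co (p i) c <= N%:R.
  move=> il; have := le_trans (enorm_coord _ c) (near _ il); rewrite !mxE ler_norml => /andP[h1 h2].
  have NE : N%:R * h = 2 * (D%:R * s).
    by rewrite /N natrM /h -mulrA [_ * (s / _)]mulrC divfK ?pnatr_eq0 // natrM mulrA.
  rewrite /co divr_ge0 ?(ltW h0) //=; last by lra.
  by rewrite ler_pdivrMr // NE; lra.
have cinj : {in l &, injective (fun i => cell (p i))}.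
  move=> i j il jl /ffunP cij; apply: contrapT => /eqP ij.
  have : enorm (p i - p j) < s.
    apply: (le_lt_trans (enorm_le_sum _)).
    apply: (@le_lt_trans _ _ (\sum_(c < d) h)).
      apply: ler_sum => c _; rewrite !mxE.
      have /andP[a1 a2] := coN _ c il; have /andP[b1 b2] := coN _ c jl.
      have := cij c; rewrite !ffunE => /(congr1 val) /=.
      have NS : N%:R < N.+1%:R :> R by rewrite ltr_nat.
      rewrite !inordK ?ltnS ?truncn_le_nat ?(le_lt_trans a2 NS) ?(le_lt_trans b2 NS) //.
      move=> e.
      have /andP[e1 e2] := truncn_itv a1; have /andP[e3 e4] := truncn_itv b1.
      rewrite e in e1 e2; rewrite -natr1 in e2 e4.
      have dE : p i ord0 c - p j ord0 c = (co (p i) c - co (p j) c) * h.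
        by rewrite /co -mulrBl divfK ?gt_eqF //; ring.
      rewrite dE normrM (gtr0_norm h0) ger_pMl // ler_norml; lra.
    rewrite sumr_const card_ord -mulr_natr /h -mulrA gtr_pMr //.
    by rewrite mulrC ltr_pdivrMr // mul1r ltr_nat.
  by rewrite ltNge sep.
have -> : size l = size [seq cell (p i) | i <- l] by rewrite size_map.
have /card_uniqP <- : uniq [seq cell (p i) | i <- l] by rewrite map_inj_in_uniq.
by apply: leq_trans (max_card _) _; rewrite card_ffun !card_ord.
Qed.

End Packing.

(** * Cylinder words, stopped words and their weights *)

Section IFS.
Context {R : realType} {d : nat}.
Notation V := 'rV[R]_d.
Variables (m : nat) (f : 'I_m -> V -> V) (rho : 'I_m -> R).

Definition fw (w : seq 'I_m) (x : V) : V := foldr f x w.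
Definition rw (w : seq 'I_m) : R := \prod_(i <- w) rho i.

Lemma fw_cat u v x : fw (u ++ v) x = fw u (fw v x).
Proof. by rewrite /fw foldr_cat. Qed.

Lemma rw_cons i w : rw (i :: w) = rho i * rw w.
Proof. by rewrite /rw big_cons. Qed.

Lemma rw_nil : rw [::] = 1.
Proof. by rewrite /rw big_nil. Qed.

Fixpoint words (k : nat) : seq (seq 'I_m) :=
  if k is k'.+1 then [seq i :: w | i <- enum 'I_m, w <- words k'] else [:: [::]].

Lemma mem_words k w : (w \in words k) = (size w == k).
Proof.
elim: k w => [|k IH] [|i w] //=.
  by apply/allpairsP => -[[j v]] [_ _].
rewrite eqSS -IH; apply/allpairsP/idP => [[[j v] /= [_ vk [_ ->]]] //|wk].
by exists (i, w); rewrite mem_enum.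
Qed.

Lemma sum_wordsS (F : seq 'I_m -> R) k :
  \sum_(w <- words k.+1) F w = \sum_(i < m) \sum_(w <- words k) F (i :: w).
Proof. by rewrite /= big_allpairs_dep /= big_enum. Qed.

Hypothesis rho01 : forall i, 0 < rho i < 1.
Hypothesis simf : forall i, is_similarity (f i) (rho i).

Let rho_gt0 i : 0 < rho i. Proof. by have /andP[] := rho01 i. Qed.
Let rho_lt1 i : rho i < 1. Proof. by have /andP[] := rho01 i. Qed.

Lemma rw_gt0 w : 0 < rw w.
Proof. by rewrite /rw prodr_gt0. Qed.

Lemma fw_sim w : is_similarity (fw w) (rw w).
Proof.
elim: w => [|i w IH] x y; first by rewrite rw_nil mul1r.
by rewrite /= simf IH rw_cons mulrA.
Qed.

Lemma fw_inj w : injective (fw w).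
Proof.
move=> x y /eqP; rewrite -subr_eq0 -enorm_eq0 fw_sim mulf_eq0 gt_eqF ?rw_gt0 //=.
by rewrite enorm_eq0 subr_eq0 => /eqP.
Qed.

Lemma rho_bounds : exists2 a, 0 < a <= 1 & forall i, a <= rho i <= 1 - a.
Proof.
pose F i := Num.min (rho i) (1 - rho i).
pose a := \big[Num.min/1]_(i < m) F i.
exists a.
  rewrite /a; apply/andP; split.
    elim/big_ind: _ => // [x y hx hy|i _]; first by rewrite lt_min hx hy.
    by rewrite /F lt_min rho_gt0 subr_gt0 rho_lt1.
  elim/big_ind: _ => // [x y hx hy|i _]; first by rewrite ge_min hx.
  by rewrite /F ge_min ltW.
move=> i; have : a <= F i by rewrite /a (bigD1 i) //= ge_min lexx.
rewrite /F le_min => /andP[-> h] /=; lra.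
Qed.

Lemma fw0_bounded : exists2 B, 0 <= B & forall w, enorm (fw w 0) <= B.
Proof.
have [a /andP[a0 a1] ha] := rho_bounds.
pose F := \sum_(i < m) enorm (f i 0).
have F0 : 0 <= F by apply: sumr_ge0 => i _; exact: enorm_ge0.
(* [F / a] is the fixed point of [B -> F + (1 - a) B], so the bound survives each further letter. *)
exists (F / a); first by rewrite divr_ge0 // ltW.
elim => [|i w IH] /=; first by rewrite enorm0 divr_ge0 // ltW.
have := enormB_triangle (f i 0) (f i (fw w 0)) 0; rewrite !subr0 => /le_trans; apply.
rewrite simf subr0.
have h1 : enorm (f i 0) <= F.
  by rewrite /F (bigD1 i) //= lerDl sumr_ge0 // => j _; exact: enorm_ge0.
have /andP[_ h2] := ha i.
have h3 : rho i * enorm (fw w 0) <= (1 - a) * (F / a).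
  by apply: ler_pM; rewrite ?enorm_ge0 // ltW.
have h4 : (1 - a) * (F / a) = F / a - F by field; rewrite gt_eqF.
lra.
Qed.

(** The shortest prefix of ratio at most [eta], the threshold being divided by each ratio read; the
    whole word if no prefix qualifies. *)
Fixpoint cutp (eta : R) (w : seq 'I_m) : seq 'I_m :=
  if 1 <= eta then [::] else if w is i :: w' then i :: cutp (eta / rho i) w' else [::].

Lemma cutp_prefix eta w : prefix (cutp eta w) w.
Proof.
elim: w eta => [|i w IH] eta /=; first by case: ifP.
by case: ifP => _ //=; rewrite eqxx IH.
Qed.

Lemma rw_cutp_le eta w : rw w <= eta -> rw (cutp eta w) <= eta.
Proof.
elim: w eta => [|i w IH] eta /=; case: (leP 1 eta) => // h; rewrite ?rw_nil //.
by rewrite !rw_cons -!ler_pdivlMl // ![_^-1 * _]mulrC; exact: IH.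
Qed.

Lemma rw_cutp_ge a eta w : 0 < a -> (forall i, a <= rho i) -> a * eta <= 1 ->
  a * eta <= rw (cutp eta w).
Proof.
move=> a0 ha; elim: w eta => [|i w IH] eta h /=; case: (leP 1 eta) => h1; rewrite ?rw_nil //.
rewrite rw_cons -ler_pdivrMl // mulrC -mulrA; apply: IH.
rewrite mulrA ler_pdivrMr // mul1r.
by apply: le_trans (ha i); rewrite ger_pMr // ltW.
Qed.

(** A proper prefix of a stopped word still has ratio above [eta], hence is not a stopped word
    itself. *)
Lemma cutp_antichain eta w w' : rw w <= eta -> rw w' <= eta ->
  prefix (cutp eta w) (cutp eta w') -> cutp eta w = cutp eta w'.
Proof.
elim: w eta w' => [|i w IH] eta [|j w'] /=; case: (leP 1 eta) => // h; rewrite ?rw_nil //.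
  by move=> h1; have := lt_le_trans h h1; rewrite ltxx.
rewrite prefix_cons !rw_cons => h1 h2 /andP[/eqP ij].
rewrite -{}ij in h2 * => h3; congr (_ :: _); apply: IH h3.
- by rewrite ler_pdivlMr // mulrC.
- by rewrite ler_pdivlMr // mulrC.
Qed.

Section Pressure.
Variable t : R.
Hypothesis t0 : 0 <= t.

Definition pw w := rw w `^ t.
Definition Sp := \sum_(i < m) rho i `^ t.
(** The maximum serves two regimes: it equals [Sp] in the mass argument, where [Sp >= 1], and 1 in
    the energy estimates, where [Sp < 1]. *)
Definition Mp := Num.max 1 Sp.

Lemma pw_cons i w : pw (i :: w) = rho i `^ t * pw w.
Proof. by rewrite /pw rw_cons powRM // ltW // rw_gt0. Qed.

Lemma Mp_ge1 : 1 <= Mp. Proof. by rewrite le_max lexx. Qed.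

Lemma sum_pw k : \sum_(w <- words k) pw w = Sp ^+ k.
Proof.
elim: k => [|k IH]; first by rewrite big_seq1 /pw rw_nil powR1.
rewrite sum_wordsS exprS /Sp mulr_suml; apply: eq_bigr => i _.
by under eq_bigr do rewrite pw_cons; rewrite -mulr_sumr IH.
Qed.

(** The level-[k] words below [v] weigh [pw v * Sp^(k - |v|)]; as [Mp >= 1], the exponent may be
    raised to [k], uniformly in [v]. *)
Lemma sum_pw_prefix k v : \sum_(w <- words k | prefix v w) pw w <= pw v * Mp ^+ k.
Proof.
have M0 : 0 <= Mp by rewrite (le_trans ler01) // Mp_ge1.
elim: v k => [|i v IH] k.
  rewrite (eq_bigl xpredT) => [|w]; last by rewrite prefix0s.
  rewrite sum_pw /pw rw_nil powR1 mul1r lerXn2r ?nnegrE //.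
    by apply: sumr_ge0 => i _; exact: powR_ge0.
  by rewrite le_max lexx orbT.
case: k => [|k].
  by rewrite big_cons big_nil /= mulr_ge0 ?exprn_ge0 // powR_ge0.
rewrite big_mkcond sum_wordsS (bigD1 i) //= [X in _ + X]big1 ?addr0; last first.
  by move=> j ji; rewrite big1 // => w _; rewrite eq_sym (negPf ji).
under eq_bigr do rewrite eqxx pw_cons /=.
rewrite -big_mkcond -mulr_sumr pw_cons -mulrA ler_wpM2l ?powR_ge0 //.
apply: le_trans (IH k) _; rewrite ler_wpM2l ?powR_ge0 //.
by rewrite exprS ler_peMl ?exprn_ge0 ?Mp_ge1.
Qed.

End Pressure.
End IFS.

(** * Separation and counting under the open set condition *)

Section OSC.
Context {R : realType} {d : nat}.
Notation V := 'rV[R]_d.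

Lemma open_eball_sub (O : set V) x : open O -> O x -> exists2 e, 0 < e & eball x e `<=` O.
Proof.
move=> oO Ox; have /nbhs_ballP[e /= e0 he] : nbhs x O by exact: open_nbhs_nbhs.
exists e => // y ye; apply: he; split => // i j; rewrite (ord1 i) /ball /= distrC.
by have := le_lt_trans (enorm_coord (y - x) j) ye; rewrite !mxE.
Qed.

Variables (m : nat) (f : 'I_m -> V -> V) (rho : 'I_m -> R).
Hypothesis rho01 : forall i, 0 < rho i < 1.
Hypothesis simf : forall i, is_similarity (f i) (rho i).

Section Separation.
Variable O : set V.
Hypothesis subO : forall i, f i @` O `<=` O.
Hypothesis disjO : forall i j, i != j -> f i @` O `&` f j @` O = set0.

Lemma fw_subO w x : O x -> O (fw f w x).
Proof. by elim: w => //= i w IH Ox; apply: (subO (i := i)); exists (fw f w x) => //; exact: IH. Qed.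

(** Common letters cancel by injectivity; the first differing letters place the two points in
    disjoint images of [O]. *)
Lemma fw_disjO u v x y : ~~ prefix u v -> ~~ prefix v u -> O x -> O y -> fw f u x <> fw f v y.
Proof.
elim: u v => [|i u IH] [|j v]; rewrite ?prefix0s //.
rewrite !prefix_cons (eq_sym j i) /=; have [->|ij] := eqVneq i j.
  move=> /= h1 h2 Ox Oy /(fw_inj rho01 simf (w := [:: j])) /=; exact: IH.
move=> _ _ Ox Oy e; have : (f i @` O `&` f j @` O) (f i (fw f u x)).
  by split; [exists (fw f u x) | rewrite e; exists (fw f v y)] => //; exact: fw_subO.
by rewrite disjO.
Qed.

(** Were [fw v o] closer, it would, by surjectivity of [fw u], be the image under [fw u] of a point
    within [r0] of [o], hence of a point of [O], against the disjointness of the two images of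
    [O]. *)
Lemma antichain_separated o r0 u v : 0 < r0 -> eball o r0 `<=` O ->
  ~~ prefix u v -> ~~ prefix v u ->
  rw rho u * r0 <= enorm (fw f u o - fw f v o).
Proof.
move=> r00 ballO h1 h2; rewrite leNgt; apply/negP => h.
have [z zE] := similarity_surj (fw_sim simf u) (rw_gt0 rho01 u) (fw f v o).
have Oz : O z.
  apply: ballO; rewrite /eball /= -(ltr_pM2l (rw_gt0 rho01 u)) -(fw_sim simf) zE.
  by rewrite enormBC.
have Oo : O o by apply: ballO; rewrite /eball /= subrr enorm0.
exact: (fw_disjO h1 h2 Oz Oo).
Qed.

End Separation.

Hypothesis osc : exists O : set V, open O /\ O !=set0 /\
  (forall i, f i @` O `<=` O) /\ (forall i j, i != j -> f i @` O `&` f j @` O = set0).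

(* Each word counted on the left has a prefix [v] with [rw v] comparable to [eta]; these
   prefixes form an antichain, so the open set condition bounds how many there are. *)
Lemma near_sum_pw (D : R) : 0 <= D -> exists C : nat, forall t eta y k,
  0 <= t -> 0 < eta <= 1 ->
  \sum_(w <- words m k | (rw rho w <= eta) && (enorm (fw f w 0 - y) <= D * eta)) pw rho t w
    <= C%:R * eta `^ t * Mp rho t ^+ k.
Proof.
move=> D0; have [U [oU [[z0 Uz0] [subO disjO]]]] := osc.
have [r0 r00 ballO] := open_eball_sub oU Uz0.
have [a /andP[a0 a1] ha] := rho_bounds rho01.
have [B B0 hB] := fw0_bounded rho01 simf.
(* Stopped words have ratio between [a * eta] and [eta]: their points [fw v z0] are [a * eta * r0]
   apart and within [eta * (|z0| + B + D)] of [y]. [D'] is the quotient. *)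
pose D' := ((enorm z0 + B + D) / (a * r0)).
have ar0 : 0 < a * r0 by rewrite mulr_gt0.
have D'0 : 0 <= D' by rewrite divr_ge0 ?(ltW ar0) // !addr_ge0 // enorm_ge0.
pose DN := (Num.truncn D').+1.
have DN1 : D' <= DN%:R by apply: ltW; have /andP[] := truncn_itv D'0.
exists (((2 * DN * d.+1).+1) ^ d)%N => t eta y k t0 /andP[eta0 eta1].
set cond := fun w => (rw rho w <= eta) && (enorm (fw f w 0 - y) <= D * eta).
pose l := undup [seq cutp rho eta w | w <- words m k & cond w].
have lP v : v \in l -> [/\ rw rho v <= eta, a * eta <= rw rho v,
     (exists2 w, rw rho w <= eta & v = cutp rho eta w) &
     enorm (fw f v z0 - y) <= DN%:R * (a * eta * r0)].
  rewrite mem_undup => /mapP[w]; rewrite mem_filter => /andP[/andP[c1 c2] _] ->.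
  set v' := cutp rho eta w.
  have v1 : rw rho v' <= eta by exact: rw_cutp_le.
  split => //.
  - apply: rw_cutp_ge => // [i|]; first by have /andP[] := ha i.
    by rewrite mulr_ile1 // ltW.
  - by exists w.
  have /prefixP[u wE] := cutp_prefix rho eta w.
  have e1 : enorm (fw f v' z0 - fw f w 0) <= eta * (enorm z0 + B).
    rewrite wE fw_cat (fw_sim simf) -/v'; apply: ler_pM => //.
    - by rewrite ltW // rw_gt0.
    - exact: enorm_ge0.
    by apply: le_trans (enormD _ _) _; rewrite enormN lerD2l.
  have e2 := enormB_triangle (fw f w 0) (fw f v' z0) y.
  have -> : DN%:R * (a * eta * r0) = DN%:R * (a * r0) * eta by ring.
  have e3 : (enorm z0 + B + D) <= DN%:R * (a * r0) by rewrite -ler_pdivrMr.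
  have : (enorm z0 + B + D) * eta <= DN%:R * (a * r0) * eta by rewrite ler_pM2r.
  lra.
have szl : (size l <= ((2 * DN * d.+1).+1) ^ d)%N.
  apply: (@separated_points_le _ _ _ l (fun v => fw f v z0) y (a * eta * r0)).
  - by rewrite !mulr_gt0.
  - exact: undup_uniq.
  - move=> u v /lP[u1 u2 [u' u3 uE] _] /lP[v1 v2 [v' v3 vE] _] uv.
    apply: (@le_trans _ _ (rw rho u * r0)); first by rewrite ler_pM2r.
    apply: (antichain_separated subO disjO r00 ballO); apply/negP => h; case/eqP: uv.
      by rewrite uE vE in h *; exact: (cutp_antichain rho01 u3 v3 h).
    by rewrite uE vE in h *; rewrite (cutp_antichain rho01 v3 u3 h).
  - by move=> v /lP[].
have M0 : 0 <= Mp rho t by rewrite (le_trans ler01) // Mp_ge1.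
apply: (@le_trans _ _ (\sum_(v <- l) \sum_(w <- words m k | prefix v w) pw rho t w)).
  rewrite big_mkcond /=; under [leRHS]eq_bigr do rewrite big_mkcond.
  rewrite exchange_big /= big_seq [leRHS]big_seq; apply: ler_sum => w wk.
  case: ifPn => c; last first.
    by apply: sumr_ge0 => v _; case: ifP => // _; exact: powR_ge0.
  have vl : cutp rho eta w \in l by rewrite mem_undup map_f // mem_filter wk andbT.
  rewrite (big_rem _ vl) /= cutp_prefix lerDl sumr_ge0 // => v _.
  by case: ifP => // _; exact: powR_ge0.
apply: (@le_trans _ _ (\sum_(v <- l) (eta `^ t * Mp rho t ^+ k))).
  rewrite big_seq [leRHS]big_seq; apply: ler_sum => v /lP[v1 _ _ _].
  apply: (le_trans (sum_pw_prefix rho01 t k v)); rewrite ler_wpM2r ?exprn_ge0 //.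
  by rewrite ge0_ler_powR // nnegrE ltW // rw_gt0.
rewrite big_const_seq count_predT iter_addr_0 -[leLHS]mulr_natl -mulrA.
by rewrite ler_wpM2r ?ler_nat // mulr_ge0 ?powR_ge0 ?exprn_ge0.
Qed.

End OSC.

(** * The similarity dimension *)

Section Mass.
Context {R : realType} {d : nat}.
Notation V := 'rV[R]_d.
Variables (m : nat) (f : 'I_m -> V -> V) (rho : 'I_m -> R).
Hypothesis rho01 : forall i, 0 < rho i < 1.
Hypothesis simf : forall i, is_similarity (f i) (rho i).

(** By Bernoulli, [(1 - a)^s <= 1 / (1 + s a)], so about [1 / a] letters halve the ratio. Word
    length is thus at most linear in the logarithm of the ratio. *)
Lemma rw_decay : exists2 s, (0 < s)%N & forall j (w : seq 'I_m), (s * j <= size w)%N ->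
  rw rho w <= 2 ^- j.
Proof.
have [a /andP[a0 a1] ha] := rho_bounds rho01.
have b0 : 0 <= 1 - a by rewrite subr_ge0.
have b1 : 1 - a <= 1 by rewrite gerBl ltW.
have H w : rw rho w <= (1 - a) ^+ size w.
  elim: w => [|i w IH]; first by rewrite rw_nil.
  rewrite rw_cons exprS; apply: ler_pM => //; last by have /andP[] := ha i.
    by have /andP[/ltW] := rho01 i.
  by rewrite ltW // rw_gt0.
have B k : (1 - a) ^+ k * (1 + k%:R * a) <= 1.
  elim: k => [|k IH]; first by rewrite mul0r addr0 mulr1.
  apply: le_trans IH; rewrite exprSr -mulrA ler_wpM2l ?exprn_ge0 // -natr1.
  have : 0 <= k%:R :> R by [].
  nra.
pose s := (Num.truncn a^-1).+1.
have sa : 1 <= s%:R * a.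
  rewrite -ler_pdivrMr // mul1r ltW //.
  have ai0 : 0 <= a^-1 by rewrite invr_ge0 ltW.
  by have /andP[] := truncn_itv ai0.
have hs : (1 - a) ^+ s <= 2^-1.
  have := B s; have := exprn_ge0 s b0; nra.
exists s => // j w jw; apply: le_trans (H w) _.
apply: (@le_trans _ _ ((1 - a) ^+ (s * j))); first by rewrite ler_wiXn2l.
by rewrite exprM -exprVn lerXn2r // nnegrE ?exprn_ge0.
Qed.

Lemma exists_expVn2_le (e : R) : 0 < e -> exists j, 2 ^- j <= e.
Proof.
move=> e0; exists (Num.truncn e^-1); rewrite -[leRHS]invrK lef_pV2 ?posrE ?exprn_gt0 ?invr_gt0 //.
have ei0 : 0 <= e^-1 by rewrite invr_ge0 ltW.
have /andP[_ /ltW h] := truncn_itv ei0.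
apply: (le_trans h); rewrite -natrX ler_nat; by apply: ltn_expl.
Qed.

Variable E : set V.
Hypothesis fE : forall i, f i @` E `<=` E.
Hypothesis osc : exists O : set V, open O /\ O !=set0 /\
  (forall i, f i @` O `<=` O) /\ (forall i j, i != j -> f i @` O `&` f j @` O = set0).

(* If [Sp >= 1], the level-[k] cylinders carry total weight [Sp ^ k], of which a ball of
   radius [eta] captures at most [C * eta ^ t * Sp ^ k]. *)
Lemma cover_mass x0 t : E x0 -> 0 <= t -> 1 <= Sp rho t -> exists C : nat,
  forall (J : seq nat) (y : nat -> V) (eta : nat -> R),
  (forall j, j \in J -> 0 < eta j <= 1) ->
  (forall x, E x -> exists2 j, j \in J & enorm (x - y j) < eta j) ->
  1 <= C%:R * \sum_(j <- J) eta j `^ t.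
Proof.
move=> Ex0 t0 S1.
(* [fw w x0] is within [eta] of the centre of its ball, and [fw w 0] within [eta * |x0|] of
   [fw w x0]. *)
have D0 : 0 <= enorm x0 + 1 by rewrite addr_ge0 ?enorm_ge0.
have [C hC] := near_sum_pw rho01 simf osc D0.
exists C => J y eta eta01 cov.
have [e [e0 he]] : exists e, 0 < e /\ forall j, j \in J -> e <= eta j.
  elim: (J) eta01 => [|j s IH] h; first by exists 1.
  have [|e [e0 he]] := IH; first by move=> i si; apply: h; rewrite in_cons si orbT.
  exists (Num.min e (eta j)); split.
    by rewrite lt_min e0; have /andP[] := h j (mem_head _ _).
  move=> i; rewrite in_cons ge_min => /orP[/eqP->|/he ->//]; by rewrite lexx orbT.
have [n hn] := exists_expVn2_le e0.
have [s s0 hs] := rw_decay.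
(* Deep enough for every word of this level to have ratio below the smallest radius [e]. *)
pose k := (s * n)%N.
have Mp_Sp : Mp rho t = Sp rho t by rewrite /Mp; exact/max_idPr.
have Sk : 0 < Sp rho t ^+ k by rewrite exprn_gt0 // (lt_le_trans ltr01).
rewrite -(ler_pM2r Sk) mul1r -[leLHS](sum_pw rho01) mulr_sumr mulr_suml.
pose cond j w := (rw rho w <= eta j) && (enorm (fw f w 0 - y j) <= (enorm x0 + 1) * eta j).
apply: (@le_trans _ _ (\sum_(j <- J) \sum_(w <- words m k | cond j w) pw rho t w)); last first.
  rewrite big_seq [leRHS]big_seq; apply: ler_sum => j jJ.
  by rewrite -Mp_Sp; apply: hC => //; exact: eta01.
under [leRHS]eq_bigr do rewrite big_mkcond.
rewrite exchange_big /= big_seq [leRHS]big_seq; apply: ler_sum => w.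
rewrite mem_words => /eqP wk.
have Ew : E (fw f w x0) by elim: (w) => //= i u IH; apply: (fE (i := i)); exists (fw f u x0).
have [j jJ hj] := cov _ Ew.
rewrite (big_rem _ jJ) /=.
have rj : rw rho w <= eta j by rewrite (le_trans (hs n _ _)) ?wk // (le_trans hn) // he.
have -> : cond j w.
  rewrite /cond rj /=; have := enormB_triangle (fw f w x0) (fw f w 0) (y j).
  rewrite (fw_sim simf) sub0r enormN.
  have : rw rho w * enorm x0 <= eta j * enorm x0 by rewrite ler_wpM2r ?enorm_ge0.
  lra.
rewrite lerDl sumr_ge0 // => i _; case: ifP => // _; exact: powR_ge0.
Qed.

Lemma sum_subiota_le (J : seq nat) n (F : nat -> R) : uniq J -> (forall k, 0 <= F k) ->
  (forall j, j \in J -> (j < n)%N) -> \sum_(j <- J) F j <= \sum_(j < n) F j.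
Proof.
move=> uJ F0 hJ.
have pe : perm_eq J [seq j <- iota 0 n | j \in J].
  apply: uniq_perm => //; first by rewrite filter_uniq // iota_uniq.
  move=> j; rewrite mem_filter mem_iota add0n /=.
  by case jJ: (j \in J) => //=; rewrite hJ.
rewrite (perm_big _ pe) big_filter -(big_mkord xpredT) /index_iota subn0 /=.
by rewrite big_mkcond; apply: ler_sum => j _; case: ifP.
Qed.

(* The sets of a cover are fattened to balls with [eta_k ^ t = diam(U_k) ^ t + c / 2 ^ (k + 1)]. *)
Lemma hausdorff0_ball_cover t c : 0 < t -> 0 < c -> 2 * c <= 1 -> compact E ->
  hausdorff_measure t E = 0%E ->
  exists (J : seq nat) (y : nat -> V) (eta : nat -> R),
  [/\ forall j, j \in J -> 0 < eta j <= 1,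
      forall x, E x -> exists2 j, j \in J & enorm (x - y j) < eta j &
      \sum_(j <- J) eta j `^ t <= 2 * c].
Proof.
move=> t0 c0 c1 cE HE.
have : (hausdorff_delta t 1 E < c%:E)%E.
  apply: (@le_lt_trans _ _ (hausdorff_measure t E)); last by rewrite HE lte_fin.
  by apply: ereal_sup_ubound; exists 1 => /=.
move=> /ereal_inf_lt[_ [U [U1 [EU ->]]] hU].
have Hk k : exists h y, [/\ 0 <= h, hcost t (U k) = h%:E &
    forall x, U k x -> enorm (x - y) `^ t <= h].
  rewrite /hcost; case: asboolP => [U0|/eqP/set0P[y Uy]].
    by exists 0, 0; split => // x; rewrite U0.
  exists (fine (ediam (U k)) `^ t), y; split => //; first exact: powR_ge0.
  move=> x Ux; have hxy : ((enorm (x - y))%:E <= ediam (U k))%E.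
    by apply: ereal_sup_ubound; exists x, y.
  have := U1 k; case: (ediam (U k)) hxy => //= D; rewrite !lee_fin => h1 h2.
  by rewrite ge0_ler_powR ?nnegrE ?enorm_ge0 ?(le_trans (enorm_ge0 _) h1) // ltW.
have /choice[h /choice[y hy]] := Hk.
have h0 k : 0 <= h k by have [] := hy k.
(* The extra term lets open balls contain the sets, even those of diameter zero, and adds at most
   [c] in total. *)
pose e k := h k + c / 2 ^+ k.+1.
have e0 k : 0 < e k by rewrite ltr_wpDl // divr_gt0 // exprn_gt0.
pose eta k := e k `^ t^-1.
have etaE k : eta k `^ t = e k by rewrite /eta -powRrM mulVf ?gt_eqF // powRr1 // ltW.
have eta0 k : 0 < eta k by rewrite powR_gt0.
have sub k : U k `<=` eball (y k) (eta k).
  move=> x Ux; have [_ _ /(_ x Ux) hx] := hy k; rewrite /eball /= ltNge; apply/negP => hle.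
  have : eta k `^ t <= enorm (x - y k) `^ t.
    by rewrite ge0_ler_powR ?nnegrE ?enorm_ge0 // ltW.
  rewrite etaE => h1; have := le_trans h1 hx; rewrite /e leNgt ltrDl.
  by rewrite divr_gt0 // exprn_gt0.
have Sn n : \sum_(k < n) h k <= c.
  have hE : (\sum_(k < n) (h k)%:E <= \sum_(k <oo) hcost t (U k))%E.
    rewrite -(big_mkord xpredT (fun k => (h k)%:E)).
    rewrite (eq_bigr (fun k => hcost t (U k))); last by move=> k _; have [_ ->] := hy k.
    by apply: nneseries_lim_ge => k _; have [? ->] := hy k; rewrite lee_fin.
  by rewrite -lee_fin -sumEFin (le_trans hE) // ltW.
have en n : \sum_(k < n) e k <= 2 * c.
  rewrite big_split /= mulrDl mul1r; apply: lerD; first exact: Sn.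
  suff -> : \sum_(k < n) c / 2 ^+ k.+1 = c - c / 2 ^+ n by rewrite gerBl divr_ge0 ?exprn_ge0 // ltW.
  elim: n => [|n IH]; first by rewrite big_ord0 expr0 divr1 subrr.
  by rewrite big_ord_recr /= IH exprS; field; rewrite expf_neq0.
move: cE; rewrite compact_cover => /(_ nat setT (fun k => eball (y k) (eta k))).
case=> [k _|x /EU[k _ /sub Ukx]|J' _ covJ]; first exact: open_eball.
  by exists k.
pose J := finmap.enum_fset J'.
have SJ (K : seq nat) : uniq K -> \sum_(j <- K) e j <= 2 * c.
  move=> uK; apply: le_trans (en (\max_(j <- K) j).+1).
  apply: sum_subiota_le => // [k|j jK]; first exact: ltW.
  by rewrite ltnS leq_bigmax_seq.
exists J, y, eta; split.
- move=> j _; rewrite eta0 /=.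
  have : e j <= 1 by have := SJ [:: j] isT; rewrite big_seq1 => /le_trans; apply.
  move=> ej; have <- : 1 `^ t^-1 = 1 :> R by rewrite powR1.
  rewrite /eta ge0_ler_powR ?nnegrE //; last exact: ltW.
  by rewrite invr_ge0 ltW.
- by move=> x /covJ[j /= jJ xj]; exists j.
- by under eq_bigr do rewrite etaE; apply: SJ; exact: finmap.fset_uniq.
Qed.

(** Zero measure yields finite ball covers of arbitrarily small [t]-cost, whereas [Sp >= 1] bounds
    this cost from below by [1 / C]. *)
Lemma hausdorff0_Sp_lt1 t : 0 < t -> E !=set0 -> compact E ->
  hausdorff_measure t E = 0%E -> Sp rho t < 1.
Proof.
move=> t0 [x0 Ex0] cE HE; rewrite ltNge; apply/negP => S1.
have [C hC] := cover_mass Ex0 (ltW t0) S1.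
pose c : R := (2 * C.+1%:R)^-1 / 2.
have C0 : 0 < C.+1%:R :> R by [].
have c0 : 0 < c by rewrite divr_gt0 // invr_gt0 mulr_gt0.
have cE2 : 2 * c * C.+1%:R = 2^-1 by rewrite /c; field; rewrite addrC natr1 gt_eqF.
have c1 : 2 * c <= 1.
  have : 2 * c <= 2 * c * C.+1%:R by rewrite ler_pMr ?mulr_gt0 // ler1n.
  by rewrite cE2; lra.
have [J [y [eta [h1 h2 h3]]]] := hausdorff0_ball_cover t0 c0 c1 cE HE.
have := hC J y eta h1 h2.
have : C%:R * \sum_(j <- J) eta j `^ t <= C%:R * (2 * c) by rewrite ler_wpM2l.
have : C%:R * (2 * c) <= C.+1%:R * (2 * c) by rewrite ler_pM2r ?mulr_gt0 // ler_nat.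
rewrite [C.+1%:R * _]mulrC cE2; lra.
Qed.

End Mass.

(** * Energy of the cylinder points with given letter counts *)

Section Regularity.
Context {R : realType} {d : nat}.
Notation V := 'rV[R]_d.

Lemma powR_le1 (x a : R) : 0 <= x <= 1 -> 0 <= a -> x `^ a <= 1.
Proof.
move=> /andP[x0 x1] a0; have <- : 1 `^ a = 1 :> R by rewrite powR1.
by rewrite ge0_ler_powR ?nnegrE.
Qed.

Lemma powRX (x t : R) n : 0 <= x -> (x ^+ n) `^ t = (x `^ t) ^+ n.
Proof. by move=> x0; rewrite -(powR_mulrn n x0) powRAC powR_mulrn ?powR_ge0. Qed.

Lemma powR_expVn (a : R) n : (2 ^- n) `^ a = (2 `^ (- a)) ^+ n.
Proof. by rewrite -exprVn powRX ?invr_ge0 // -(powR_inv1 (a := 2)) // -powRrM mulN1r. Qed.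

Lemma gdec_le (sg a u : R) : 0 < sg -> 0 <= a -> 0 < u -> gdec sg a u <= (sg / u) `^ a.
Proof.
move=> sg0 a0 u0; rewrite /gdec; case: ifP => // h.
rewrite -[leLHS](powRr0 (sg / u)) ler_powR //.
by rewrite ler_pdivlMr // mul1r.
Qed.

(** Layer decomposition of the kernel: at distance about [2^j sg] it is about [2^(-a j)]. Energies
    thereby reduce to counts of points in balls, which the open set condition controls. *)
Lemma gdec_dyadic (sg a u : R) n : 0 < sg -> 0 <= a ->
  gdec sg a u <= (2 `^ (- a)) ^+ n
    + \sum_(j < n) (u <= 2 ^+ j.+1 * sg)%R%:R * (2 `^ (- a)) ^+ j.
Proof.
move=> sg0 a0; set b := 2 `^ (- a).
have b0 : 0 <= b by exact: powR_ge0.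
elim: n => [|n IH].
  rewrite expr0 big_ord0 addr0 /gdec; case: (leP u sg) => // h.
  have u0 : 0 < u by exact: lt_trans h.
  by rewrite powR_le1 // divr_ge0 ?(ltW sg0) ?(ltW u0) //= ler_pdivrMr // mul1r ltW.
rewrite big_ord_recr /=; case: (leP u) => h; rewrite ?mul1r ?mul0r ?addr0.
  apply: (le_trans IH); by rewrite [X in _ <= _ + X]addrC lerDr exprn_ge0.
have u0 : 0 < u by apply: lt_trans h; rewrite mulr_gt0 ?exprn_gt0.
apply: (le_trans (gdec_le sg0 a0 u0)).
have : (sg / u) `^ a <= b ^+ n.+1.
  rewrite -powR_expVn.
  rewrite ge0_ler_powR ?nnegrE ?divr_ge0 ?invr_ge0 ?exprn_ge0 ?(ltW sg0) ?(ltW u0) //.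
  by rewrite ler_pdivrMr // mulrC ler_pdivlMr ?exprn_gt0 // mulrC ltW.
move=> h1; apply: (le_trans h1); rewrite lerDl sumr_ge0 // => j _.
by rewrite mulr_ge0 // exprn_ge0.
Qed.

Variables (m : nat) (f : 'I_m -> V -> V) (rho : 'I_m -> R).
Hypothesis rho01 : forall i, 0 < rho i < 1.
Hypothesis simf : forall i, is_similarity (f i) (rho i).
Hypothesis osc : exists O : set V, open O /\ O !=set0 /\
  (forall i, f i @` O `<=` O) /\ (forall i j, i != j -> f i @` O `&` f j @` O = set0).

(* Words with the same letter counts have the same contraction ratio, so the ratios need
   not be discretised. *)
Definition words_of (kap : 'I_m -> nat) : seq (seq 'I_m) :=
  [seq w <- words m (\sum_i kap i)%N | [forall i, count_mem i w == kap i]].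

Definition ratio_of (kap : 'I_m -> nat) : R := \prod_i rho i ^+ kap i.

Lemma mem_words_of w kap : (forall i, count_mem i w = kap i) -> w \in words_of kap.
Proof.
move=> h; rewrite mem_filter mem_words; apply/andP; split; first by apply/forallP => i; rewrite h.
rewrite (eq_bigr (fun i => count_mem i w)) => [|i _]; last by rewrite h.
elim: w {h} => [|j w IH]; first by rewrite big1.
rewrite [X in _ == X](eq_bigr (fun i => (j == i) + count_mem i w)%N) // big_split /= -(eqP IH).
by rewrite (bigD1 j) //= eqxx big1 // => i /negPf; rewrite eq_sym => ->.
Qed.

Lemma rw_words_of w kap : w \in words_of kap -> rw rho w = ratio_of kap.
Proof.
rewrite mem_filter => /andP[/forallP h _]; rewrite /rw /ratio_of.
under [RHS]eq_bigr do rewrite -(eqP (h _)).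
elim: w {h} => [|j w IH]; first by rewrite big_nil big1.
rewrite big_cons IH [RHS](eq_bigr (fun i => rho i ^+ (j == i) * rho i ^+ count_mem i w)).
  rewrite big_split /=; congr (_ * _).
  by rewrite (bigD1 j) //= eqxx big1 ?mulr1 // => i /negPf; rewrite eq_sym => ->.
by move=> i _; rewrite exprD.
Qed.

Variable t : R.
Hypotheses (t0 : 0 < t) (Sp1 : Sp rho t < 1).

Let Mp1 : Mp rho t = 1. Proof. exact/max_idPl/ltW. Qed.

(** Words of one class have equal weight, so the weighted sum is a plain count; [Sp < 1] gives
    [Mp = 1], hence no loss in the word length. *)
Lemma near_words_of (D : R) : 0 <= D -> exists C : nat, forall kap eta y,
  0 < eta <= 1 -> ratio_of kap <= eta ->
  (\sum_(w <- words_of kap) (enorm (fw f w 0 - y) <= D * eta)%R%:R) * ratio_of kap `^ t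
    <= C%:R * eta `^ t.
Proof.
move=> D0; have [C hC] := near_sum_pw rho01 simf osc D0.
exists C => kap eta y eta01 rk.
have := hC t eta y (\sum_i kap i)%N (ltW t0) eta01.
rewrite Mp1 expr1n mulr1; apply: le_trans.
rewrite mulr_suml [leRHS](bigID (fun w => w \in words_of kap)) /=.
apply: ler_wpDr; first by apply: sumr_ge0 => w _; exact: powR_ge0.
rewrite {1}/words_of big_filter big_mkcond [leRHS]big_mkcond /=.
rewrite big_seq [leRHS]big_seq; apply: ler_sum => w wk.
have -> : (w \in words_of kap) = [forall i, count_mem i w == kap i] by rewrite mem_filter wk andbT.
case: ifPn => hw; last by rewrite andbF.
have rE : rw rho w = ratio_of kap by apply: rw_words_of; rewrite mem_filter hw.
rewrite andbT rE rk /=; case: ifP => _; last by rewrite mul0r.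
by rewrite mul1r /pw rE.
Qed.

Lemma size_words_of kap : (size (words_of kap))%:R * ratio_of kap `^ t <= 1.
Proof.
apply: (@le_trans _ _ (Sp rho t ^+ (\sum_i kap i)%N)); last first.
  apply: exprn_ile1; last exact: ltW.
  by apply: sumr_ge0 => i _; exact: powR_ge0.
rewrite -(sum_pw rho01) -[size _]count_predT -sum1_count natr_sum mulr_suml.
rewrite {1}/words_of big_filter big_mkcond big_seq [leRHS]big_seq; apply: ler_sum => w wk.
case: ifPn => hw; last exact: powR_ge0.
have rE : rw rho w = ratio_of kap by apply: rw_words_of; rewrite mem_filter hw.
by rewrite mul1r /pw rE.
Qed.

(** [f'] stands for grid maps, of which only the closeness of their points is used. A ball of radius
    [2^(j + 1 - n)] holds [O(2^(t j))] points and the kernel there is [O(2^(-a j))]; as [a <= t],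
    each of the [n] layers contributes [O(2^(n (t - a)))], whence the factor [n + 1]. *)
Lemma Gbounded_words_of (alpha K c : R) : let a := (1 - K^-1) ^+ d * alpha in
  1 < K -> 0 <= a <= t -> 0 < c -> exists2 C, 0 <= C &
  forall n kap (f' : 'I_m -> V -> V), c * 2 ^- n <= ratio_of kap <= 2 ^- n ->
    (forall w, w \in words_of kap -> enorm (fw f' w 0 - fw f w 0) <= 2 ^- n) ->
    Gbounded alpha K n [seq fw f' w 0 | w <- words_of kap] (C * n.+1%:R * (2 `^ (t - a)) ^+ n).
Proof.
move=> a K1 /andP[a0 at_] c0; have K0 : 0 < K by exact: lt_trans K1.
(* The layers have radius [2 K eta], and passing from [f'] to [f] costs [2^-n <= eta]. *)
have D0 : 0 <= 2 * K + 1 by rewrite addr_ge0 // mulr_ge0 // ltW.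
have [C0 hC0] := near_words_of D0.
set beta := 2 `^ (t - a); set b := 2 `^ (- a); set T := 2 `^ t; set ct := c `^ t.
have b0 : 0 <= b by exact: powR_ge0.
have T0 : 0 < T by exact: powR_gt0.
have ct0 : 0 < ct by exact: powR_gt0.
have betaE : beta = T * b by rewrite /beta powRD // pnatr_eq0 implybT.
have beta1 : 1 <= beta.
  by rewrite /beta -[leLHS](powRr0 2) ler_powR ?ler1n // subr_ge0.
have beta0 : 0 <= beta by exact: powR_ge0.
have K2a : 0 <= (2 * K) `^ a by exact: powR_ge0.
exists (ct^-1 * (1 + C0%:R * T + (2 * K) `^ a)).
  by rewrite mulr_ge0 ?invr_ge0 ?(ltW ct0) // !addr_ge0 // mulr_ge0 // ltW.
move=> n kap f' /andP[rk1 rk2] hf.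
have sg0 : 0 < 2 * K * 2 ^- n by rewrite !mulr_gt0 // invr_gt0 exprn_gt0.
have rkt : ct / T ^+ n <= ratio_of kap `^ t.
  have -> : ct / T ^+ n = (c * 2 ^- n) `^ t.
    rewrite powRM ?invr_ge0 ?exprn_ge0 ?(ltW c0) // powR_expVn /T powRN exprVn //.
  by rewrite ge0_ler_powR ?nnegrE ?(le_trans _ rk1) ?mulr_ge0 ?invr_ge0 ?exprn_ge0 // ltW.
(* Dividing by the weight of a single word, at least [c^t 2^(-n t)], turns weight bounds into
   cardinality bounds. *)
have cancel N M : 0 <= N -> N * ratio_of kap `^ t <= M -> N <= ct^-1 * (T ^+ n * M).
  move=> N0 h; rewrite mulrA -ler_pdivrMl ?mulr_gt0 ?invr_gt0 ?exprn_gt0 //.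
  rewrite invfM invrK mulrC; exact: le_trans (ler_wpM2l N0 rkt) h.
have N0 : (size (words_of kap))%:R <= ct^-1 * T ^+ n.
  by rewrite -[T ^+ n]mulr1; apply: cancel => //; exact: size_words_of.
have Tb : T ^+ n * b ^+ n = beta ^+ n by rewrite betaE exprMn.
have ct10 : 0 <= ct^-1 by rewrite invr_ge0 ltW.
have bn0 : 0 <= beta ^+ n by rewrite exprn_ge0.
have CT0 : 0 <= C0%:R * T by rewrite mulr_ge0 // ltW.
have nb : 1 <= n.+1%:R :> R by rewrite ler1n.
split.
  rewrite big_map big_const_seq count_predT iter_addr_0 -[leLHS]mulr_natl.
  apply: (@le_trans _ _ (ct^-1 * T ^+ n * ((2 * K) `^ a * b ^+ n))).
    apply: ler_pM => //; first exact: gdec_ge0.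
    rewrite /b -powR_expVn -powRM ?mulr_ge0 ?invr_ge0 ?exprn_ge0 ?(ltW K0) //.
    by have := @gdec_le _ a 1 sg0 a0 ltr01; rewrite divr1.
  have -> : ct^-1 * T ^+ n * ((2 * K) `^ a * b ^+ n) = ct^-1 * (2 * K) `^ a * beta ^+ n.
    by rewrite -Tb; ring.
  rewrite ler_wpM2r // -mulrA ler_wpM2l //.
  apply: (@le_trans _ _ (1 + C0%:R * T + (2 * K) `^ a)); first by rewrite lerDr addr_ge0.
  by rewrite ler_peMr // !addr_ge0.
move=> y _; rewrite big_map.
pose ind j w := (enorm (fw f' w 0 - y) <= 2 ^+ j.+1 * (2 * K * 2 ^- n))%R%:R : R.
apply: (@le_trans _ _ (\sum_(w <- words_of kap) (b ^+ n + \sum_(j < n) ind j w * b ^+ j))).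
  by apply: ler_sum => w _; exact: gdec_dyadic.
rewrite big_split /= exchange_big /= big_const_seq count_predT iter_addr_0 -[X in X + _]mulr_natl.
have Nj (j : 'I_n) : \sum_(w <- words_of kap) ind j w <= ct^-1 * (C0%:R * T) * T ^+ j.
  set eta : R := 2 ^+ j.+1 * 2 ^- n.
  have eta0 : 0 < eta by rewrite mulr_gt0 ?invr_gt0 ?exprn_gt0.
  have eta1 : eta <= 1.
    by rewrite /eta ler_pdivrMr ?exprn_gt0 // mul1r ler_eXn2l ?ltr1n.
  have eta2 : 2 ^- n <= eta by rewrite ler_peMl ?invr_ge0 ?exprn_ge0 // exprn_ege1 // ler1n.
  have hN := hC0 kap eta y; rewrite eta0 eta1 (le_trans rk2 eta2) in hN.
  have {}hN := hN isT isT.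
  have etat : T ^+ n * eta `^ t = T * T ^+ j.
    rewrite /eta powRM ?invr_ge0 ?exprn_ge0 // powRX // powR_expVn powRN exprVn -/T.
    by rewrite exprS mulrC divfK // expf_neq0 // gt_eqF.
  have -> : ct^-1 * (C0%:R * T) * T ^+ j = ct^-1 * (T ^+ n * (C0%:R * eta `^ t)).
    by rewrite [T ^+ n * _]mulrCA etat; ring.
  apply: cancel; first by apply: sumr_ge0 => w _; exact: ler0n.
  apply: le_trans hN; rewrite ler_wpM2r ?powR_ge0 //.
  rewrite big_seq [leRHS]big_seq; apply: ler_sum => w ww; rewrite /ind ler_nat.
  case: (boolP (_ <= 2 ^+ _ * _)%R) => // h1.
  suff -> : enorm (fw f w 0 - y) <= (2 * K + 1) * eta by [].
  have h2 := enormB_triangle (fw f' w 0) (fw f w 0) y.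
  have h3 := hf w ww; rewrite enormBC in h3.
  have h4 : 2 ^+ j.+1 * (2 * K * 2 ^- n) = 2 * K * eta by rewrite /eta; ring.
  rewrite h4 in h1; lra.
apply: (@le_trans _ _ (ct^-1 * beta ^+ n + \sum_(j < n) ct^-1 * (C0%:R * T) * beta ^+ n)).
  apply: lerD; first by rewrite -Tb mulrA ler_wpM2r // exprn_ge0.
  apply: ler_sum => j _; rewrite -mulr_suml.
  apply: (@le_trans _ _ (ct^-1 * (C0%:R * T) * T ^+ j * b ^+ j)).
    by rewrite ler_wpM2r ?exprn_ge0.
  rewrite -mulrA -exprMn -betaE ler_wpM2l ?(mulr_ge0 ct10 CT0) //.
  by rewrite ler_weXn2l // ltnW.
rewrite sumr_const card_ord -[X in _ + X]mulr_natl -[n.+1%:R]natr1.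
have : 0 <= ct^-1 * beta ^+ n by exact: mulr_ge0.
set z := ct^-1 * beta ^+ n => z0.
have -> : n%:R * (ct^-1 * (C0%:R * T) * beta ^+ n) = z * (C0%:R * T * n%:R) by rewrite /z; ring.
have -> : ct^-1 * (1 + C0%:R * T + (2 * K) `^ a) * (n%:R + 1) * beta ^+ n =
   z * ((1 + C0%:R * T + (2 * K) `^ a) * (n%:R + 1)) by rewrite /z; ring.
rewrite -{1}[z]mulr1 -mulrDr ler_wpM2l //.
have n0 : 0 <= n%:R :> R by [].
nra.
Qed.

End Regularity.

(** * Discretised systems *)

Section Grid.
Context {R : realType} {d : nat}.
Notation V := 'rV[R]_d.
Variables (m B : nat).

(** The number of steps of length [1 / (B 2^n)] in [[-B, B]]. The single parameter [B] bounds the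
    entries, sets the resolution and bounds the letter counts by [B n]. *)
Definition gsize (n : nat) : nat := (2 * B * B * 2 ^ n)%N.

Definition gval (n : nat) (k : 'I_(gsize n).+1) : R := k%:R / (B%:R * 2 ^+ n) - B%:R.

(* A discretised candidate at scale [2^-n]: affine maps with matrix entries on a grid,
   together with a word type. There are only exponentially many of them in [n]. *)
Definition gfam (n : nat) : finType :=
  ({ffun 'I_m -> 'M['I_(gsize n).+1]_d * 'rV['I_(gsize n).+1]_d} *
   {ffun 'I_m -> 'I_(B * n).+1})%type.

Definition gmap (n : nat) (p : {ffun 'I_m -> 'M['I_(gsize n).+1]_d * 'rV['I_(gsize n).+1]_d})
  (i : 'I_m) (x : V) : V := x *m map_mx (@gval n) (p i).1 + map_mx (@gval n) (p i).2.

Definition gpts (n : nat) (p : gfam n) : seq V :=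
  [seq fw (gmap p.1) w 0 | w <- words_of (fun i => p.2 i)].

Lemma card_gfam : exists C M, forall n, (#|gfam n| <= C * 2 ^ (M * n))%N.
Proof.
exists ((2 * B * B + 1) ^ ((d * d + d) * m) * (B + 1) ^ m)%N, ((d * d + d) * m + m)%N => n.
rewrite card_prod !card_ffun card_prod !card_mx !card_ord mul1n -expnD -expnM.
have h1 : ((gsize n).+1 <= (2 * B * B + 1) * 2 ^ n)%N.
  by rewrite mulnDl mul1n -addn1 leq_add2l expn_gt0.
have h2 : ((B * n).+1 <= (B + 1) * 2 ^ n)%N.
  rewrite mulnDl mul1n -addn1; apply: leq_add; last by rewrite expn_gt0.
  by rewrite leq_mul2l ltnW ?orbT // ltn_expl.
have le_exp (u v e : nat) : (u <= v)%N -> (u ^ e <= v ^ e)%N.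
  by case: e => // e uv; rewrite leq_exp2r.
apply: leq_trans (leq_mul (le_exp _ _ _ h1) (le_exp _ _ _ h2)) _.
by rewrite !expnMn -!expnM mulnACA -expnD -mulnDr mulnC [(n * _)%N]mulnC [leqRHS]mulnC.
Qed.

Lemma gval_approx n (x : R) : (0 < B)%N -> `|x| <= B%:R ->
  exists k, `|x - @gval n k| <= (B%:R * 2 ^+ n)^-1.
Proof.
move=> B0; rewrite ler_norml => /andP[x1 x2].
have BR : 0 < B%:R :> R by rewrite ltr0n.
set s := B%:R * 2 ^+ n; have s0 : 0 < s by rewrite mulr_gt0 // exprn_gt0.
have y0 : 0 <= (x + B%:R) * s by rewrite mulr_ge0 ?(ltW s0) //; lra.
have /andP[k1 k2] := truncn_itv y0; set k := Num.truncn _ in k1 k2.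
have kN : (k < (gsize n).+1)%N.
  rewrite ltnS -(ler_nat R) (le_trans k1) // /gsize !natrM natrX.
  have -> : 2 * B%:R * B%:R * 2 ^+ n = 2 * B%:R * s by rewrite /s; ring.
  by rewrite ler_wpM2r ?(ltW s0) //; lra.
exists (Ordinal kN); rewrite /gval -/s /=.
have -> : x - (k%:R / s - B%:R) = ((x + B%:R) * s - k%:R) / s.
  by field; rewrite gt_eqF.
rewrite normrM normfV (gtr0_norm s0) ler_pdivrMr // mulVf ?gt_eqF //.
rewrite ler_norml; rewrite -natr1 in k2; lra.
Qed.

End Grid.

(** * Approximation of similarities on the grid, uniformly over words *)

Section Approximation.
Context {R : realType} {d : nat}.
Notation V := 'rV[R]_d.

Lemma enorm_mulmx_le (e : R) (x : V) (M : 'M[R]_d) (b : V) : 0 <= e ->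
  (forall i j, `|M i j| <= e) -> (forall j, `|b ord0 j| <= e) ->
  enorm (x *m M + b) <= d%:R * (d%:R + 1) * (enorm x + 1) * e.
Proof.
move=> e0 hM hb.
apply: (@le_trans _ _ (\sum_(j < d) (d%:R * enorm x * e + e))).
  apply: (le_trans (enorm_le_sum _)); apply: ler_sum => j _; rewrite !mxE.
  apply: (le_trans (ler_normD _ _)); apply: lerD => //.
  apply: (le_trans (ler_norm_sum _ _ _)).
  apply: (@le_trans _ _ (\sum_(k < d) enorm x * e)).
    by apply: ler_sum => k _; rewrite normrM ler_pM // enorm_coord.
  by rewrite sumr_const card_ord -[leLHS]mulr_natl mulrA.
rewrite sumr_const card_ord -[leLHS]mulr_natl -!mulrA ler_wpM2l //.
have := enorm_ge0 x; have : 0 <= d%:R :> R by [].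
move=> d0 x0; have : 0 <= d%:R * e by exact: mulr_ge0.
have : 0 <= enorm x * e by exact: mulr_ge0.
lra.
Qed.

Variables (m : nat) (f : 'I_m -> V -> V) (rho : 'I_m -> R).
Hypothesis rho01 : forall i, 0 < rho i < 1.
Hypothesis simf : forall i, is_similarity (f i) (rho i).

(** A letter contracts the previous error by [1 - a] and adds at most [a * 2^-n / 2], so the bound
    [2^-n / 2] persists along words of any length. *)
Lemma grid_approx : exists B0, forall B n, (B0 <= B)%N ->
  exists p : {ffun 'I_m -> 'M['I_(gsize B n).+1]_d * 'rV['I_(gsize B n).+1]_d},
  forall w, enorm (fw (gmap p) w 0 - fw f w 0) <= 2 ^- n / 2.
Proof.
have [a /andP[a0 a1] ha] := rho_bounds rho01.
have [M M0 hM] := fw0_bounded rho01 simf.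
pose L : R := d%:R * (d%:R + 1).
have L0 : 0 <= L by rewrite mulr_ge0 // addr_ge0.
pose F := \sum_(i < m) (\sum_(k < d) \sum_(j < d) `|sim_mx (f i) k j| + enorm (f i 0)).
have F0 : 0 <= F.
  apply: sumr_ge0 => i _; rewrite addr_ge0 ?enorm_ge0 // sumr_ge0 // => k _.
  by rewrite sumr_ge0.
have hF i : (forall k j, `|sim_mx (f i) k j| <= F) /\ (forall j, `|f i 0 ord0 j| <= F).
  have Fi : \sum_(k < d) \sum_(j < d) `|sim_mx (f i) k j| + enorm (f i 0) <= F.
    rewrite /F [leRHS](bigD1 i) //= lerDl sumr_ge0 // => i' _.
    by rewrite addr_ge0 ?enorm_ge0 // sumr_ge0 // => k _; rewrite sumr_ge0.
  have s0 : 0 <= \sum_(k < d) \sum_(j < d) `|sim_mx (f i) k j|.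
    by rewrite sumr_ge0 // => k _; rewrite sumr_ge0.
  split=> [k j|j].
    apply: le_trans Fi; apply: ler_wpDr; first exact: enorm_ge0.
    rewrite (bigD1 k) //= (bigD1 j) //= -addrA lerDl addr_ge0 ?sumr_ge0 // => k' _.
    by rewrite sumr_ge0.
  by apply: le_trans Fi; apply: ler_wpDl => //; exact: enorm_coord.
(* [F] makes the entries fit on the grid; the middle term makes the one-letter error
   [L (M + 2) / (B 2^n)] at most [a * 2^-n / 2]. *)
pose x0 := F + 2 * (L * (M + 2)) / a + 1.
have x00 : 0 <= x0 by rewrite /x0 !addr_ge0 // divr_ge0 ?(ltW a0) // !mulr_ge0 // addr_ge0.
exists (Num.truncn x0).+1 => B n hB.
have /andP[_ /ltW x0B] := truncn_itv x00.
have {}x0B : x0 <= B%:R by rewrite (le_trans x0B) // ler_nat.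
have z0 : 0 <= 2 * (L * (M + 2)) / a by rewrite divr_ge0 ?(ltW a0) // !mulr_ge0 // addr_ge0.
have FB : F <= B%:R by rewrite (le_trans _ x0B) // /x0; lra.
have LB : 2 * (L * (M + 2)) <= B%:R * a.
  by rewrite -ler_pdivrMr // (le_trans _ x0B) // /x0; lra.
have B0 : (0 < B)%N by apply: leq_trans hB.
have BR : 0 < B%:R :> R by rewrite ltr0n.
have app (x : R) : `|x| <= F -> exists k, `|x - @gval R B n k| <= (B%:R * 2 ^+ n)^-1.
  by move=> hx; apply: gval_approx => //; exact: le_trans hx FB.
have hp i : exists q : 'M['I_(gsize B n).+1]_d * 'rV['I_(gsize B n).+1]_d,
    (forall k j, `|(sim_mx (f i) - map_mx (@gval R B n) q.1) k j| <= (B%:R * 2 ^+ n)^-1) /\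
    (forall j, `|(f i 0 - map_mx (@gval R B n) q.2) ord0 j| <= (B%:R * 2 ^+ n)^-1).
  have [h1 h2] := hF i.
  have /choice[q1 hq1] : forall kj : 'I_d * 'I_d, exists c,
      `|sim_mx (f i) kj.1 kj.2 - @gval R B n c| <= (B%:R * 2 ^+ n)^-1.
    by move=> kj; exact: app.
  have /choice[q2 hq2] : forall j : 'I_d, exists c,
      `|f i 0 ord0 j - @gval R B n c| <= (B%:R * 2 ^+ n)^-1.
    by move=> j; exact: app.
  exists (\matrix_(k, j) q1 (k, j), \row_j q2 j); split => [k j|j]; rewrite !mxE.
    by have := hq1 (k, j); rewrite /= !mxE.
  exact: hq2.
have /choice[p hpp] := hp.
exists [ffun i => p i]; set g := gmap _; set e : R := (B%:R * 2 ^+ n)^-1.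
have e0 : 0 <= e by rewrite invr_ge0 mulr_ge0 ?exprn_ge0.
have fg i x : enorm (g i x - f i x) <= L * (enorm x + 1) * e.
  have [h1 h2] := hpp i.
  rewrite (similarity_affine (simf i) x) /g /gmap ffunE enormBC.
  rewrite opprD addrACA -mulmxBr.
  exact: enorm_mulmx_le.
have n0 : 0 < 2 ^- n :> R by rewrite invr_gt0 exprn_gt0.
have n1 : 2 ^- n <= 1 :> R by rewrite invf_le1 ?exprn_gt0 // exprn_ege1 // ler1n.
have eE : e * B%:R = 2 ^- n.
  by rewrite /e invfM mulrAC mulVf ?mul1r // gt_eqF.
elim => [|i w IH] /=; first by rewrite subrr enorm0 divr_ge0 // ltW.
apply: (le_trans (enormB_triangle (f i (fw g w 0)) _ _)).
have h1 := fg i (fw g w 0); rewrite simf.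
have h2 : enorm (fw g w 0) <= M + 1.
  have := enormB_triangle (fw f w 0) (fw g w 0) 0; rewrite !subr0.
  have := hM w; lra.
have h3 : rho i * enorm (fw g w 0 - fw f w 0) <= (1 - a) * (2 ^- n / 2).
  have /andP[_ h] := ha i; have /andP[/ltW h' _] := rho01 i.
  by apply: ler_pM => //; exact: enorm_ge0.
have h4 : L * (enorm (fw g w 0) + 1) * e <= L * (M + 2) * e.
  by rewrite ler_wpM2r // ler_wpM2l //; lra.
have h5 : 2 * (L * (M + 2)) * e <= B%:R * a * e by rewrite ler_wpM2r.
have h6 : B%:R * a * e = a * 2 ^- n by rewrite -eE; ring.
rewrite h6 in h5; lra.
Qed.

End Approximation.

(** * Box dimension of the cutout *)

Section Asymptotics.
Context {R : realType}.

Lemma bernoulli_ge (x : R) n : 0 <= x -> 1 + n%:R * x <= (1 + x) ^+ n.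
Proof.
move=> x0; elim: n => [|n IH]; first by rewrite mul0r addr0.
rewrite exprS; apply: (@le_trans _ _ ((1 + x) * (1 + n%:R * x))).
  rewrite -natr1; have : 0 <= n%:R * x * x by rewrite !mulr_ge0.
  lra.
by rewrite ler_wpM2l // addr_ge0.
Qed.

Lemma bernoulli_le (x : R) n : 0 <= x <= 1 -> 1 - n%:R * x <= (1 - x) ^+ n.
Proof.
move=> /andP[x0 x1]; elim: n => [|n IH]; first by rewrite mul0r subr0.
rewrite exprS; apply: (@le_trans _ _ ((1 - x) * (1 - n%:R * x))).
  rewrite -natr1; have : 0 <= n%:R * x * x by rewrite !mulr_ge0.
  lra.
by rewrite ler_wpM2l // subr_ge0.
Qed.

Lemma eventually_poly_le_expn (tau C : R) p : 1 < tau -> 0 <= C ->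
  exists n0, forall n, (n0 <= n)%N -> (C * n.+1%:R) ^+ p <= tau ^+ n.
Proof.
move=> + C0; elim: p tau => [|p IH] tau tau1.
  by exists 0%N => n _; rewrite expr0 exprn_ege1 // ltW.
have t0 : 0 <= tau by rewrite ltW // (lt_trans ltr01).
have s1 : 1 < Num.sqrt tau by rewrite -sqrtr1 ltr_sqrt // (lt_trans ltr01).
have ss1 : 1 < Num.sqrt (Num.sqrt tau).
  by rewrite -[ltLHS]sqrtr1 ltr_sqrt // (lt_trans ltr01).
have [n1 hn1] := IH _ s1.
set x := Num.sqrt (Num.sqrt tau) - 1; have x0 : 0 < x by rewrite subr_gt0.
have y0 : 0 <= 2 * C / x ^+ 2 by rewrite divr_ge0 ?mulr_ge0 ?exprn_ge0 // ltW.
exists (maxn n1 (Num.truncn (2 * C / x ^+ 2)).+1) => n; rewrite geq_max => /andP[nn1 nn2].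
have -> : tau ^+ n = Num.sqrt tau ^+ n * Num.sqrt tau ^+ n.
  by rewrite -exprMn -expr2 sqr_sqrtr.
rewrite exprS; apply: ler_pM; rewrite ?exprn_ge0 ?mulr_ge0 //; last exact: hn1.
(* The second square root makes the Bernoulli bound quadratic in [n], which beats the linear factor
   [C (n + 1)]. *)
have -> : Num.sqrt tau ^+ n = (Num.sqrt (Num.sqrt tau) ^+ n) ^+ 2.
  by rewrite -exprM mulnC exprM sqr_sqrtr // sqrtr_ge0.
apply: (@le_trans _ _ ((1 + n%:R * x) ^+ 2)); last first.
  rewrite lerXn2r ?nnegrE ?exprn_ge0 ?sqrtr_ge0 ?addr_ge0 ?mulr_ge0 // ?(ltW x0) //.
  have -> : Num.sqrt (Num.sqrt tau) = 1 + x by rewrite /x addrC subrK.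
  by rewrite bernoulli_ge // ltW.
have /andP[_ h] := truncn_itv y0.
have h2 : 2 * C / x ^+ 2 <= n%:R by rewrite (le_trans (ltW h)) // ler_nat.
rewrite ler_pdivrMr ?exprn_gt0 // in h2.
have n1' : 1 <= n%:R :> R by rewrite ler1n (leq_trans _ nn2).
have h3 : 2 * C * n%:R <= n%:R * x ^+ 2 * n%:R by rewrite ler_wpM2r.
have h4 : C * 1 <= C * n%:R by rewrite ler_wpM2l.
have h5 : 0 <= n%:R * x by rewrite mulr_ge0 // ltW.
have -> : (1 + n%:R * x) ^+ 2 = 1 + 2 * (n%:R * x) + n%:R * x ^+ 2 * n%:R by ring.
rewrite -natr1.
lra.
Qed.

End Asymptotics.

Section BoxDimension.
Context {R : realType} {d : nat}.
Notation V := 'rV[R]_d.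

Lemma ediam_ball_le (z : V) (e : R) (U : set V) : (forall x, U x -> enorm (x - z) <= e) ->
  (ediam U <= (2 * e)%:E)%E.
Proof.
move=> h; apply/ereal_supP => _ [x [y [Ux [Uy ->]]]]; rewrite lee_fin.
have := enormB_triangle z x y; have := h _ Ux; have := h _ Uy.
rewrite (enormBC z y); lra.
Qed.

Lemma covnum_le (F : set V) (e delta : R) (s : seq V) : 2 * e <= delta ->
  (forall x, F x -> exists2 z, z \in s & enorm (x - z) <= e) ->
  exists2 c, covnum delta F = c%:E & 0 <= c <= (size s)%:R.
Proof.
move=> he cov.
have h1 : (covnum delta F <= ((size s)%:R)%:E)%E.
  apply: ereal_inf_lbound; exists (size s) => //.
  exists (fun i => [set x | enorm (x - nth 0 s i) <= e]); split => [i|x /cov[z zs xz]].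
    apply: le_trans (ediam_ball_le (z := nth 0 s i) (e := e) _) _ => //.
  have iz : (index z s < size s)%N by rewrite index_mem.
  by exists (Ordinal iz); rewrite /= nth_index.
have h0 : (0 <= covnum delta F)%E.
  by apply/ereal_infP => _ [n _ <-]; rewrite lee_fin.
case: (covnum delta F) h0 h1 => [c||] //; rewrite !lee_fin => h0 h1.
by exists c => //; rewrite h0.
Qed.

(** The least [n] with [2 * 2^-n <= delta] satisfies [delta < 2^-(n - 2)], so the ratio is at most
    [th * n / (n - 2)]; for large [n] the slack [e] absorbs the shift. *)
Lemma upper_box_le (F : set V) (th e : R) n0 : 0 <= th -> 0 < e ->
  (forall n, (n0 <= n)%N -> exists2 s : seq V, (size s)%:R <= 2 `^ (th * n%:R) &
     forall x, F x -> exists2 z, z \in s & enorm (x - z) <= 2 ^- n) ->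
  (upper_box_dim F <= (th + e)%:E)%E.
Proof.
move=> th0 e0 cov.
have y0 : 0 <= 2 * th / e by rewrite divr_ge0 ?mulr_ge0 // ltW.
pose n2 := maxn n0 (Num.truncn (2 * th / e)).+3.
have p2 n : 0 < 2 ^- n :> R by rewrite invr_gt0 exprn_gt0.
apply: ge_ereal_inf; exists (ereal_sup [set box_ratio F delta | delta in
    [set delta : R | 0 < delta < 2 * 2 ^- n2]]).
  exists (2 * 2 ^- n2) => //=; rewrite mulr_gt0 //=.
  rewrite ler_pdivrMr ?exprn_gt0 // mul1r -[leLHS]expr1 ler_eXn2l ?ltr1n //.
  by rewrite /n2 leq_max orbT.
apply/ereal_supP => _ [delta /andP[dl0 dl1] <-].
have exn : exists n, 2 * 2 ^- n <= delta.
  have [n hn] := @exists_expVn2_le R (delta / 2) (divr_gt0 dl0 (ltr0Sn _ 1)).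
  by exists n; rewrite mulrC -ler_pdivlMr.
case: (ex_minnP exn) => n hn nmin.
have n2n : (n2 < n)%N.
  rewrite ltnNge; apply/negP => nn2.
  have : 2 * 2 ^- n2 <= 2 * 2 ^- n :> R.
    by rewrite ler_pM2l // lef_pV2 ?posrE ?exprn_gt0 // ler_eXn2l ?ltr1n.
  by move=> h; have := le_lt_trans (le_trans h hn) dl1; rewrite ltxx.
have nn0 : (n0 <= n)%N by apply: leq_trans (ltnW n2n); rewrite leq_maxl.
have [k nk] : exists k, n = k.+3.
  have : (3 <= n)%N by apply: leq_trans (ltnW n2n); rewrite /n2 leq_max orbT.
  by case: (n) => [|[|[|k]]] // _; exists k.
have dlk : delta < 2 ^- k.+1.
  rewrite ltNge; apply/negP => h; have := nmin k.+2; rewrite nk ltnn => hh; apply/negP: isT.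
  by apply: hh; rewrite exprS invfM mulrA divff ?mul1r.
have kth : 2 * th <= e * k.+1%:R.
  have /andP[_ /ltW h] := truncn_itv y0; rewrite [leRHS]mulrC -ler_pdivrMr //.
  apply: (le_trans h); rewrite ler_nat.
  have : (n2 <= k.+3)%N by rewrite -nk ltnW.
  by rewrite /n2 geq_max => /andP[_]; rewrite !ltnS => /leq_trans; apply.
have [s s1 s2] := cov n nn0.
have [c cE /andP[c0 c1]] := covnum_le hn s2.
rewrite /box_ratio cE lee_fin.
have ln2 : 0 < ln 2 :> R by rewrite ln_gt0 // ltr1n.
have lnd : k.+1%:R * ln 2 <= - ln delta.
  rewrite -lerN2 opprK; have -> : - (k.+1%:R * ln 2) = ln (2 ^- k.+1) :> R.
    by rewrite lnV ?posrE ?exprn_gt0 // lnXn // mulr_natl.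
  by rewrite ler_ln ?posrE // ltW.
have lnd0 : 0 < - ln delta by apply: lt_le_trans lnd; rewrite mulr_gt0.
rewrite ler_pdivrMr //.
have lnc : ln c <= th * n%:R * ln 2.
  (* An empty [F] has covering number 0, where [ln] is 0 by convention. *)
  have [cp|cn] := ltP 0 c; last by rewrite ln0 // !mulr_ge0 // ltW.
  rewrite -ln_powR ler_ln ?posrE ?powR_gt0 //; exact: le_trans c1 s1.
apply: (le_trans lnc); apply: (@le_trans _ _ ((th + e) * (k.+1%:R * ln 2))).
  rewrite mulrA ler_wpM2r ?(ltW ln2) //.
  rewrite nk -addn2 natrD; lra.
by rewrite ler_wpM2l // addr_ge0 // ltW.
Qed.

End BoxDimension.

(** * Covering the part of [E] that survives the cutouts *)

Section Covering.
Context {R : realType} {d : nat}.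
Notation V := 'rV[R]_d.

Lemma compact_enorm_bounded (E : set V) : compact E ->
  exists2 M, 0 <= M & forall x, E x -> enorm x <= M.
Proof.
rewrite compact_cover => /(_ nat setT (fun k => eball (0 : V) k.+1%:R)).
case=> [k _|x _|J _ cov]; first exact: open_eball.
  exists (Num.truncn (enorm x)) => //; rewrite /eball /= subr0.
  by have /andP[] := truncn_itv (enorm_ge0 x).
exists (\max_(j <- finmap.enum_fset J) j).+1%:R => // x /cov[j /= jJ].
rewrite /eball /= subr0 => /ltW /le_trans; apply; rewrite ler_nat ltnS.
exact: leq_bigmax_seq.
Qed.

Context {dO : measure_display} {Omega : measurableType dO}.
Variable Y : Omega -> set (V * R).

(** A cutting ball of diameter below one that contains [B(z, dl)] would be an open neighbourhood of
    [x], so it would meet the intersection of the [cutA_n], although it is removed as soon as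
    [2^-n <= p.2]. *)
Lemma void_of_cutA w x z (dl : R) : (forall p, Y w p -> 0 < p.2) -> 0 <= dl ->
  cutA Y w x -> enorm (x - z) <= dl -> void_event Y dl z 1 w.
Proof.
move=> Y0 dl0 Ax xz; rewrite /void_event /count_event /= II0 card_eq0; apply/eqP.
apply/seteqP; split => // p [Yp [h1 h2]].
have xp : eball (p.2 *: p.1) (p.2 / 2) x.
  rewrite /eball /=; have := enormB_triangle z x (p.2 *: p.1).
  rewrite (enormBC z (_ *: _)); lra.
have [y [Ay yp]] := Ax _ (open_nbhs_nbhs (conj (@open_eball _ _ _ _) xp)).
have [n hn] := @exists_expVn2_le R _ (Y0 _ Yp).
have [_] := Ay n I; apply; exists p => //; split => //=.
by rewrite hn h2.
Qed.

Variables (m : nat) (f : 'I_m -> V -> V) (rho : 'I_m -> R) (E : set V).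
Hypothesis rho01 : forall i, 0 < rho i < 1.
Hypothesis simf : forall i, is_similarity (f i) (rho i).
Hypothesis osc : exists O : set V, open O /\ O !=set0 /\
  (forall i, f i @` O `<=` O) /\ (forall i j, i != j -> f i @` O `&` f j @` O = set0).
Hypotheses (cE : compact E) (EE : E = [set y | exists i, (f i @` E) y]).

Lemma fw_E w x : E x -> E (fw f w x).
Proof. by elim: w => //= i w IH Ex; rewrite EE; exists i, (fw f w x) => //; exact: IH. Qed.

Lemma ifs_address k x : E x -> exists w y, [/\ size w = k, E y & x = fw f w y].
Proof.
elim: k x => [|k IH] x Ex; first by exists [::], x.
have : [set y | exists i, (f i @` E) y] x by rewrite -EE.
move=> [i [y /IH[w [z [<- Ez ->]]] <-]].
by exists (i :: w), z.
Qed.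

Lemma ifs_stopped a eta x : 0 < a <= 1 -> (forall i, a <= rho i) -> 0 < eta <= 1 -> E x ->
  exists w y, [/\ E y, x = fw f w y & a * eta <= rw rho w <= eta].
Proof.
move=> /andP[a0 a1] ha /andP[eta0 eta1] Ex.
have [n hn] := exists_expVn2_le eta0.
have [s s0 hs] := rw_decay rho01.
have [w [y [ws Ey ->]]] := ifs_address (s * n) Ex.
have rwe : rw rho w <= eta by rewrite (le_trans (hs n _ _)) // ws.
have /prefixP[u wE] := cutp_prefix rho eta w.
exists (cutp rho eta w), (fw f u y); split; first exact: fw_E.
  by rewrite -fw_cat -wE.
rewrite rw_cutp_le // rw_cutp_ge //.
by rewrite mulr_ile1 // ltW.
Qed.

Variables (alpha K t : R) (b na : nat).
Let a' := (1 - K^-1) ^+ d * alpha.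
Let tau : R := 2 `^ (b.+1%:R^-1).
Hypotheses (K1 : 1 < K) (t0 : 0 < t) (a't : 0 <= a' <= t) (Sp1 : Sp rho t < 1).
Hypothesis nab : t - a' + b.+1%:R^-1 <= na%:R / b.+1%:R.

Lemma Gbounded_le n X (G G' : R) : G <= G' -> @Gbounded R d alpha K n X G ->
  Gbounded alpha K n X G'.
Proof.
move=> GG' [h1 h2]; split => [|y yX]; first exact: le_trans GG'.
by apply: le_trans GG'; exact: h2.
Qed.

(** The void grid points of all admissible letter counts form the cover. The exponent is [na] from
    the energy, one more from the almost sure bound, and one more from the number of letter-count
    classes, eventually at most [tau^n]. *)
Lemma cover_bound w : (forall p, Y w p -> 0 < p.2) ->
  (forall B, exists n0, forall n (p : gfam (d := d) m B n), (n0 <= n)%N ->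
     Gbounded alpha K n (gpts (R := R) p) (tau ^+ (n * na)) ->
     nvoid Y n (gpts (R := R) p) w < tau ^+ (n * na.+1)) ->
  exists n0, forall n, (n0 <= n)%N -> exists2 s : seq V, (size s)%:R <= tau ^+ (n * na.+2) &
    forall x, (E `&` cutA Y w) x -> exists2 z, z \in s & enorm (x - z) <= 2 ^- n.
Proof.
move=> Yw0 Hw.
have tau1 : 1 < tau.
  have <- : 1 `^ (b.+1%:R^-1) = 1 :> R by rewrite powR1.
  by rewrite /tau gt0_ltr_powR ?nnegrE ?ltr1n ?invr_gt0.
have tau0 : 0 < tau by exact: lt_trans tau1.
have [a /andP[a0 a1] ha] := rho_bounds rho01.
have ha1 i : a <= rho i by have /andP[] := ha i.
have [M M0 hM] := compact_enorm_bounded cE.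
(* Points of [E] have norm at most [M], so a cylinder of ratio at most [c1 * 2^-n] lies within
   [2^-n / 2] of [fw v 0]; the other half is left for the grid error. *)
pose c1 := (2 * (M + 1))^-1.
have M10 : 0 < 2 * (M + 1) by rewrite mulr_gt0 // ltr_wpDl.
have c10 : 0 < c1 by rewrite invr_gt0.
have c1M : c1 * M <= 2^-1.
  by rewrite /c1 mulrC ler_pdivrMr //; lra.
have c11 : c1 <= 1 by rewrite invf_le1 //; lra.
pose c := a * c1.
have c0 : 0 < c by rewrite mulr_gt0.
have [C C0 hC] := Gbounded_words_of rho01 simf osc t0 Sp1 K1 a't c0.
have [B0 hB0] := grid_approx rho01 simf.
have [s s0 hs] := rw_decay rho01.
have [j0 hj0] := exists_expVn2_le c0.
(* A word of ratio at least [c * 2^-n >= 2^-(n + j0)] has fewer than [s (n + j0 + 1)] letters, which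
   is at most [B n] for [n >= 1], so its letter counts fit in [gfam]. *)
pose B := maxn B0 (s * j0.+2)%N.
have [n0 hn0] := Hw B.
have [n1 hn1] := eventually_poly_le_expn 1 tau1 C0.
have [n2 hn2] := eventually_poly_le_expn m tau1 (ler0n R B.+1).
exists (maxn (maxn n0 n1) (maxn n2 1)) => n; rewrite !geq_max => /andP[/andP[nn0 nn1] /andP[nn2 npos]].
set dl : R := 2 ^- n.
have dl0 : 0 < dl by rewrite invr_gt0 exprn_gt0.
have dl1 : dl <= 1 by rewrite invf_le1 ?exprn_gt0 // exprn_ege1 // ler1n.
have [p1 hp1] := hB0 B n (leq_maxl _ _).
pose good (k : {ffun 'I_m -> 'I_(B * n).+1}) : bool :=
  (c * dl <= ratio_of rho (fun i => k i) <= dl).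
pose pt k : gfam (d := d) m B n := (p1, k).
have hgood k : good k -> nvoid Y n (gpts (R := R) (pt k)) w < tau ^+ (n * na.+1).
  move=> gk; apply: hn0 => //.
  apply: Gbounded_le (hC n (fun i => k i) (gmap p1) gk _); last first.
    move=> u _; apply: (le_trans (hp1 u)); rewrite ler_pdivrMr // -/dl; lra.
  have := hn1 n nn1; rewrite expr1 => h.
  apply: (@le_trans _ _ (tau ^+ n * (2 `^ (t - a')) ^+ n)).
    by rewrite ler_wpM2r // exprn_ge0 // powR_ge0.
  rewrite -exprMn mulnC exprM lerXn2r ?nnegrE ?exprn_ge0 ?mulr_ge0 ?powR_ge0 ?(ltW tau0) //.
  rewrite /tau -powRD ?pnatr_eq0 ?implybT // -powR_mulrn ?powR_ge0 // -powRrM.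
  rewrite ler_powR ?ler1n // addrC (le_trans nab) // mulrC //.
pose Vd k := [seq z <- gpts (R := R) (pt k) | `[< void_event Y dl z 1 w >]].
exists (flatten [seq Vd k | k <- enum {ffun 'I_m -> 'I_(B * n).+1} & good k]).
  rewrite size_flatten sumnE /shape big_map big_map natr_sum.
  rewrite big_filter big_enum_cond /=.
  apply: (@le_trans _ _ (\sum_(k : {ffun 'I_m -> 'I_(B * n).+1}) tau ^+ (n * na.+1))).
    rewrite big_mkcond /=; apply: ler_sum => k _; case: ifPn => gk; last by rewrite exprn_ge0 ?ltW.
    apply: le_trans (ltW (hgood k gk)).
    rewrite /Vd size_filter -sum1_count natr_sum big_mkcond /nvoid /countA.
    apply: ler_sum => z _; rewrite indicE -/dl.
    by case: asboolP => // h; rewrite mem_set.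
  rewrite sumr_const -[leLHS]mulr_natl card_ffun !card_ord.
  rewrite [(n * na.+2)%N]mulnS exprD ler_wpM2r ?exprn_ge0 ?(ltW tau0) //.
  apply: le_trans (hn2 n nn2).
  rewrite natrX lerXn2r ?nnegrE ?mulr_ge0 // -natrM ler_nat.
  by rewrite mulSn mulnS addSn ltnS addnA leq_addl.
move=> x [Ex Ax].
have eta01 : 0 < c1 * dl <= 1 by rewrite mulr_gt0 //= mulr_ile1 // ltW.
have [v [y [Ey xE /andP[rv1 rv2]]]] := ifs_stopped (introT andP (conj a0 a1)) ha1 eta01 Ex.
have szv : (size v < (B * n).+1)%N.
  rewrite ltnS leqNgt; apply/negP => h.
  have h2 : (s * (n + j0).+1 <= size v)%N.
    apply: leq_trans (ltnW h); apply: (@leq_trans (s * j0.+2 * n)); last first.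
      by rewrite leq_mul2r leq_maxr orbT.
    rewrite -mulnA leq_mul2l; apply/orP; right.
    rewrite !mulSn -addnS leq_add2l -addn1 addnC leq_add // leq_pmulr //.
  have := hs _ _ h2; rewrite leNgt => /negP; apply.
  apply: lt_le_trans rv1.
  rewrite mulrA -/c (@lt_le_trans _ _ (2 ^- j0 * dl)) // ?ler_wpM2r ?(ltW dl0) //.
  rewrite /dl -invfM -exprD ltf_pV2 ?posrE ?exprn_gt0 // ltr_eXn2l ?ltr1n //.
  by rewrite addnC.
pose k : {ffun 'I_m -> 'I_(B * n).+1} := [ffun i => inord (count_mem i v)].
have kE i : k i = count_mem i v :> nat.
  by rewrite ffunE inordK // (leq_ltn_trans (count_size _ _)).
have vk : v \in words_of (fun i => k i) by apply: mem_words_of => i; rewrite kE.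
have gk : good k.
  rewrite /good -(rw_words_of rho vk) /c -mulrA rv1 (le_trans rv2) //.
  by rewrite ler_piMl // ltW.
pose z := fw (gmap p1) v (0 : V).
have xz : enorm (x - z) <= dl.
  have h1 := enormB_triangle (fw f v 0) x z.
  have h2 := hp1 v; rewrite enormBC -/z -/dl in h2.
  have h3 : enorm (x - fw f v 0) <= c1 * dl * M.
    rewrite xE (fw_sim simf) subr0; apply: ler_pM => //; [|exact: enorm_ge0|exact: hM].
    by rewrite ltW // rw_gt0.
  have h4 : c1 * dl * M <= 2^-1 * dl by rewrite mulrAC ler_wpM2r // ltW.
  lra.
exists z => //; apply/flattenP; exists (Vd k).
  by apply/mapP; exists k => //; rewrite mem_filter gk mem_enum.
rewrite mem_filter; apply/andP; split; last by apply/mapP; exists v.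
by apply/asboolP; exact: (void_of_cutA Yw0 (ltW dl0) Ax xz).
Qed.

End Covering.

(** * One null set for all parameters, and the choice of parameters for a given [E] *)

Theorem theorem11p7 (R : realType) (d : nat) (r alpha : R)
  (dO : measure_display) (Omega : measurableType dO)
  (P : probability Omega R) (Y : Omega -> set ('rV[R]_d * R)) :
  0 < r -> is_PPP P Y r ->
  alpha%:E = (r%:E * lebd (eball (0 : 'rV[R]_d) (2^-1)))%E ->
  0 < alpha -> alpha < d%:R ->
  exists N : set Omega, measurable N /\ P N = 0%E /\
    forall w, ~ N w ->
      forall E : set ('rV[R]_d),
        self_similar_OSC E -> (alpha%:E < dimH E)%E ->
        (upper_box_dim (E `&` cutA Y w) <= dimH E - alpha%:E)%E.
Proof.
move=> r0 YP alE al0 ald.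
have d0 : (0 < d)%N by rewrite -(ltr0n R) (lt_trans al0).
pose tau (b : nat) : R := 2 `^ (b.+1%:R^-1).
have tau0 b : 0 < tau b by exact: powR_gt0.
have tauX b : tau b ^+ b.+1 = 2.
  by rewrite -powR_mulrn ?powR_ge0 // -powRrM mulVf ?powRr1 // pnatr_eq0.
have K1 k : 1 < k.+2%:R :> R by rewrite ltr1n.
(* All five parameters are natural numbers, so one null set serves every choice; [E] only selects
   among them. *)
pose fine_at (i : nat * nat * nat * nat * nat) (w : Omega) :=
  let: (m, B, na, b, k) := i in exists n0, forall n (p : gfam (d := d) m B n), (n0 <= n)%N ->
    Gbounded alpha k.+2%:R n (gpts (R := R) p) (tau b ^+ (n * na)) ->
    nvoid Y n (gpts (R := R) p) w < tau b ^+ (n * na.+1).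
have /choice[bad hbad] : forall i, exists N : set Omega,
    measurable N /\ P N = 0%E /\ forall w, ~ N w -> fine_at i w.
  move=> [[[[m B] na] b] k]; have [C [M hCM]] := card_gfam (d := d) m B.
  exact: (nvoid_borel_cantelli YP d0 r0 al0 alE (K1 k) _ _ hCM (tau0 b) (tauX b)).
pose bads (j : nat) := if unpickle j is Some i then bad i else set0.
have [N [mN PN subN]] : P.-negligible (\bigcup_j bads j).
  apply: negligible_bigcup => j; rewrite /bads; case: unpickle => [i|]; last exact: negligible_set0.
  by have [h1 [h2 _]] := hbad i; exists (bad i); split.
exists N; split=> //; split=> // w Nw E [m [f [rho [fr [E0 [cE [EE osc]]]]]]].
have rho01 i : 0 < rho i < 1 by have [] := fr i.
have simf i : is_similarity (f i) (rho i) by have [] := fr i.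
have good i : fine_at i w.
  have [_ [_ h]] := hbad i; apply: h => bw; apply: Nw; apply: subN.
  exists (pickle i); first exact: I.
  rewrite /bads pickleK; exact: bw.
have Yw0 p : Y w p -> 0 < p.2 by have [h _] := YP; exact: h.
case hE : (dimH E) => [h||]; [|by rewrite addye // leey|by []].
rewrite lte_fin => alh.
suff main (e : R) : 0 < e ->
    (upper_box_dim (E `&` cutA Y w) <= h%:E - alpha%:E + e%:E)%E.
  by apply/lee_addgt0Pr => e e0; exact: main.
move=> e0.
(* [e] is spent in quarters: [t] above the dimension, [a'] below [alpha], rounding of the exponent,
   and the passage to the box dimension. *)
have : (dimH E < (h + e / 4)%:E)%E by rewrite hE lte_fin ltrDl divr_gt0.
move=> /ereal_inf_lt[_ [t' [t00 Ht] <-]]; rewrite lte_fin; set t : R := t' => th.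
have ht : h <= t by rewrite -lee_fin -hE; apply: ereal_inf_lbound; exists t.
have t0 : 0 < t by lra.
have Sp1 : Sp rho t < 1.
  apply: (hausdorff0_Sp_lt1 rho01 simf (E := E)) => // i y [x Ex <-].
  by rewrite EE; exists i, x.
have k0 : 0 <= 4 * (alpha * d%:R) / e by rewrite divr_ge0 ?mulr_ge0 // ltW.
(* By Bernoulli [(1 - 1/K)^d >= 1 - d / K], so [K >= 4 alpha d / e] costs at most [e / 4]. *)
pose k := Num.truncn (4 * (alpha * d%:R) / e); set K : R := k.+2%:R.
have Kpos : 0 < K by rewrite ltr0n.
have hK : alpha * (d%:R / K) <= e / 4.
  have /andP[_ kk] := truncn_itv k0; rewrite -/k in kk.
  have {}kk : 4 * (alpha * d%:R) / e <= K by rewrite (le_trans (ltW kk)) // ler_nat.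
  rewrite mulrA ler_pdivrMr //; rewrite ler_pdivrMr // in kk; lra.
set a' := (1 - K^-1) ^+ d * alpha.
have Kinv : 0 <= K^-1 <= 1 by rewrite invr_ge0 ltW //= invf_le1 // ler1n.
have a'1 : alpha - e / 4 <= a'.
  have h1 : (1 - d%:R * K^-1) * alpha <= a' by rewrite /a' ler_pM2r // bernoulli_le.
  have h2 : (1 - d%:R * K^-1) * alpha = alpha - alpha * (d%:R / K) by ring.
  by apply: le_trans h1; rewrite h2 lerB.
have a't : 0 <= a' <= t.
  have /andP[K2 K3] := Kinv.
  rewrite /a' mulr_ge0 ?exprn_ge0 ?subr_ge0 ?(ltW al0) //=.
  apply: (@le_trans _ _ alpha); last lra.
  by rewrite ler_piMl ?(ltW al0) // exprn_ile1 ?subr_ge0 // gerBl.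
have b0 : 0 <= 16 / e by rewrite divr_ge0 // ltW.
pose b := Num.truncn (16 / e).
have bpos : 0 < b.+1%:R :> R by rewrite ltr0n.
have hb : 4 / b.+1%:R <= e / 4.
  have /andP[_ /ltW bb] := truncn_itv b0; rewrite -/b in bb.
  rewrite ler_pdivrMr //; rewrite ler_pdivrMr // in bb; lra.
have x0 : 0 <= (t - a') * b.+1%:R by rewrite mulr_ge0 // subr_ge0; have /andP[] := a't.
(* One unit rounds up and one absorbs the factor [C (n + 1)]; [cover_bound] adds two more, whence
   the error [4 / (b + 1)]. *)
pose na := (Num.truncn ((t - a') * b.+1%:R)).+2.
have /andP[na1 na2] := truncn_itv x0.
have nab : t - a' + b.+1%:R^-1 <= na%:R / b.+1%:R.
  rewrite ler_pdivlMr // mulrDl mulVf ?gt_eqF // /na -[_.+2%:R]natr1 lerD2r.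
  exact: ltW.
pose th1 := na.+2%:R / b.+1%:R : R.
have th1le : th1 <= t - a' + 4 / b.+1%:R.
  by rewrite /th1 ler_pdivrMr // mulrDl divfK ?gt_eqF // /na -addn4 natrD lerD2r.
have th10 : 0 <= th1 by rewrite divr_ge0 // ltW.
have [n0 hn0] := cover_bound rho01 simf osc cE EE (K1 k) t0 a't Sp1 nab Yw0
  (fun B => good (m, B, na, b, k)).
have e40 : 0 < e / 4 by rewrite divr_gt0.
apply: (le_trans (upper_box_le (n0 := n0) th10 e40 _)); last first.
  have sumup (u v q z : R) : u < h + e / 4 -> z <= u - v + q -> q <= e / 4 ->
      alpha - e / 4 <= v -> z + e / 4 <= h - alpha + e by lra.
  by rewrite -!EFinD lee_fin; exact: sumup th th1le hb a'1.
move=> n /hn0[s s1 s2]; exists s => //; apply: (le_trans s1).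
rewrite -powR_mulrn ?powR_ge0 // -powRrM /th1 natrM.
suff -> : b.+1%:R^-1 * (n%:R * na.+2%:R) = na.+2%:R / b.+1%:R * n%:R :> R by [].
by ring.
Qed.
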